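(* Let $P$ be a Gorenstein polytope of dimension $d$ and degree $s$. If $d \ge 3s$, then $P$ is a lattice pyramid.
   Context: A lattice polytope is the convex hull of finitely many (at least one) points of ${\mathds{Z}}^m$; its dimension is that of its affine hull, and two lattice polytopes are identified up to affine lattice-preserving isomorphism (unimodular equivalence). A lattice polytope is hollow if its relative interior contains no lattice point (a single lattice point is not hollow). For a facet $F$ of a lattice polytope $Q$ and a point $x \in \mathrm{aff}(Q)$, the lattice distance of $F$ from $x$ is $\langle u, F\rangle - \langle u, x\rangle$, where $u$ is the unique primitive integral affine functional on $\mathrm{aff}(Q)$ (with respect to the lattice ${\mathds{Z}}^m \cap \mathrm{aff}(Q)$) that is constant on $F$ and satisfies $\langle u,F\rangle > \langle u,x\rangle$ for $x$ in the relative interior. A $d$-dimensional lattice polytope $Q$ is reflexive if there is a lattice point $x$ in its relative interior such that every facet of $Q$ has lattice distance one from $x$ (the interior point need not be the origin). A lattice polytope $P$ is Gorenstein if $rP$ is reflexive for some positive integer $r$. The codegree of a $d$-dimensional lattice polytope $P$ is the smallest positive integer $r$ such that $rP$ is not hollow, and its degree is $s = d+1-r$; for a Gorenstein polytope the $r$ with $rP$ reflexive equals the codegree. A lattice polytope $P$ is a lattice pyramid if $P$ is a single lattice point, or if $P$ is unimodularly equivalent to $\mathrm{conv}(P' \times \{0\}, \{0\}\times\{1\}) \subset {\mathds{R}}^{d-1}\times{\mathds{R}}$ for some lattice polytope $P' \subset {\mathds{R}}^{d-1}$. *)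

(* Defs.v *)
From mathcomp Require Import all_boot all_order all_algebra.
From mathcomp Require Import all_classical all_reals all_analysis.

Set Implicit Arguments.
Unset Strict Implicit.
Unset Printing Implicit Defensive.

Import Order.TTheory GRing.Theory Num.Theory.
Import numFieldNormedType.Exports.

Local Open Scope classical_set_scope.
Local Open Scope ring_scope.

Section AffineGeometry.
Variables (R : realType) (m : nat).
Local Notation E := 'rV[R]_m.
Implicit Types (A F Q : set E) (x y : E).

Definition affine_set A :=
  forall x y (t : R), A x -> A y -> A ((1 - t) *: x + t *: y).

Definition affine_hull A : set E := smallest affine_set A.

Definition convex_hull A : set E := smallest (@convex_set R E) A.

(* The empty set has no dimension, so the empty face is never a facet. *)
Definition has_dim A (d : nat) :=
  exists x (V : {vspace E}),
    affine_hull A = [set x + v | v in [set` V]] /\ \dim V = d.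

Definition relint A : set E :=
  [set x | A x /\ \forall y \near within (affine_hull A) (nbhs x), A y].

(* f is only constrained on A, which is meant to be an affine subspace. *)
Definition affine_on (V : lmodType R) A (f : E -> V) :=
  forall x y (t : R), A x -> A y ->
    f ((1 - t) *: x + t *: y) = (1 - t) *: f x + t *: f y.

Definition lattice : set E := [set x | forall i, x 0 i \is a Num.int].

Definition lattice_polytope A :=
  exists s : seq E,
    [/\ s != [::], [set` s] `<=` lattice & A = convex_hull [set` s]].

Definition dilate (r : nat) A : set E := [set r%:R *: x | x in A].

Definition hollow A := relint A `&` lattice = set0.

Definition face Q F :=
  exists (h : E -> R^o) (c : R),
    [/\ affine_on (affine_hull Q) h, (forall x, Q x -> h x <= c)
      & F = Q `&` [set x | h x = c]].

Definition facet Q F :=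
  face Q F /\ exists d : nat, has_dim Q d.+1 /\ has_dim F d.

Definition integral_functional Q (h : E -> R^o) :=
  affine_on (affine_hull Q) h /\
  forall x, affine_hull Q x -> lattice x -> (h x : R) \is a Num.int.

(* Primitivity concerns the linear part: additive constants are ignored.
   Constant functionals are excluded, being of the form 2 * 0 + c. *)
Definition primitive_functional Q (h : E -> R^o) :=
  integral_functional Q h /\
  forall (k : nat) (g : E -> R^o) (c : R), integral_functional Q g ->
    (forall x, affine_hull Q x -> h x = k%:R * g x + c) -> k = 1%N.

Definition lattice_distance Q F x (delta : R) :=
  exists (h : E -> R^o) (c : R),
    [/\ primitive_functional Q h, (forall y, F y -> h y = c),
        (forall y, relint Q y -> h y < c) & delta = c - h x].

Definition reflexive_polytope Q :=
  lattice_polytope Q /\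
  exists x, [/\ lattice x, relint Q x
    & forall F, facet Q F -> lattice_distance Q F x 1].

Definition gorenstein A :=
  lattice_polytope A /\
  exists r : nat, (0 < r)%N /\ reflexive_polytope (dilate r A).

Definition has_codegree A (r : nat) :=
  [/\ (0 < r)%N, ~ hollow (dilate r A)
    & forall r' : nat, (0 < r')%N -> ~ hollow (dilate r' A) -> (r <= r')%N].

Definition has_degree A (s : nat) :=
  exists d r : nat,
    [/\ has_dim A d, has_codegree A r & (s + r)%N = d.+1].

End AffineGeometry.

Arguments lattice {R m}.

Definition unimodularly_equivalent (R : realType) (m n : nat)
    (A : set 'rV[R]_m) (B : set 'rV[R]_n) :=
  exists f : 'rV[R]_m -> 'rV[R]_n,
    [/\ affine_on (affine_hull A) f,
        set_bij (affine_hull A) (affine_hull B) f,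
        f @` (affine_hull A `&` lattice) = affine_hull B `&` lattice
      & f @` A = B].

Definition pyramid_over (R : realType) (k : nat) (B : set 'rV[R]_k)
    : set 'rV[R]_(k + 1) :=
  convex_hull ([set row_mx x 0 | x in B] `|` [set row_mx 0 1]).

Definition lattice_pyramid (R : realType) (m : nat) (A : set 'rV[R]_m) :=
  (exists x, lattice x /\ A = [set x]) \/
  exists (k : nat) (B : set 'rV[R]_k),
    [/\ has_dim A k.+1, lattice_polytope B
      & unimodularly_equivalent A (pyramid_over B)].

(* Main.v *)
Require Import Defs.
From mathcomp Require Import all_boot all_order all_algebra.
From mathcomp Require Import all_classical all_reals all_analysis.
From mathcomp Require Import ring lra zify.

(* Let x_1, ..., x_n be the lattice points generating P and C the space of value
   vectors (h(x_1), ..., h(x_n)) of affine functionals, of dimension d + 1.  A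
   facet of P is a nonnegative vector F in C of minimal support; the interior
   lattice point m of rP is a positive combination sum_i theta_i x_i with
   sum theta_i = r, and reflexivity says that F is integral as soon as it is
   normalised by F(m) = 1.  It is enough to find a facet vector equal to the
   indicator of one generator, the apex.
     Write m = sum_I lam_i x_i with (x_i)_I linearly independent, and
   1 = sum_J mu_j F_j with (F_j)_J linearly independent facets.  Both
   decompositions have total weight r >= d + 1 - s, so the matrix F_j(x_i) of
   natural numbers, weighted by lam and mu to have row and column sums 1, is
   close to a permutation matrix: with c, c' the codimensions of the spans of I
   and J, more than c + c' generators v_i of I lie off exactly one facet F_i
   of J.  If none is an apex, each v_i lies off a second facet G_i of P.  Then
   (F_i - G_i)(p_j), where p_j is the part of m carried by the generators off
   F_j, is 1 - N with N substochastic and N_ii < 1, and such a matrix has rank at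
   least half its size.  If c' <= c this is absurd: p_j may be replaced by
   p_j - v_j, which is killed by J, so the rank is at most c'.  The case c < c'
   is symmetric, F_i - G_i then being killed by I. *)

Set Implicit Arguments.
Unset Strict Implicit.
Unset Printing Implicit Defensive.

Import Order.TTheory GRing.Theory Num.Theory.

Import numFieldNormedType.Exports.

Section SubstochasticMatrices.
Variable R : realFieldType.
Local Open Scope ring_scope.

Lemma mxrank_schur n (A : 'M[R]_(1 + n)) (a := A 0 0) : a != 0 ->
  ((\rank (drsubmx A - a^-1 *: (dlsubmx A *m ursubmx A))%R).+1 <= \rank A)%N.
Proof.
move=> a0; set S := _ - _.
have Aul : ulsubmx A = a%:M.
  apply/matrixP => i j; rewrite !ord1 !mxE /= mulr1n /a.
  by congr (A _ _); apply/val_inj.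
pose L := block_mx 1%:M 0 (- a^-1 *: dlsubmx A) 1%:M : 'M[R]_(1 + n).
pose U := block_mx 1%:M (- a^-1 *: ursubmx A) 0 1%:M : 'M[R]_(1 + n).
have LAU : L *m A *m U = block_mx a%:M 0 0 S.
  rewrite -[A]submxK /L /U Aul !mulmx_block !mul0mx !mulmx0 !mul1mx !mulmx1.
  rewrite !addr0 !mul_mx_scalar !mul_scalar_mx !scalerA mulrN mulfV //.
  by rewrite !scaleN1r !addNr mul0mx add0r -scalemxAl scaleNr addrC.
have <- : \rank (block_mx (a%:M : 'M[R]_1) 0 0 S) = (\rank S).+1.
  by rewrite rank_diag_block_mx mxrank_unit ?unitmxE ?det_scalar1 ?unitfE.
rewrite -LAU; apply: leq_trans (mxrankM_maxl _ _) (mxrankM_maxr _ _).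
Qed.

(* Eliminating one index by a Schur complement keeps the matrix substochastic
   and pushes at most one further diagonal entry up to 1. *)
Lemma substochastic_rank g (N : 'M[R]_g) :
  (forall i j, 0 <= N i j) -> (forall i, \sum_j N i j <= 1) ->
  (forall i, N i i < 1) -> (g <= 2 * \rank (1%:M - N)%R)%N.
Proof.
move: {2}g (leqnn g) => k; elim: k g N => [|k IHk] [|n] N; rewrite ?leqn0 // ltnS.
move=> le_nk N0 N1 Nd.
pose p := 1 - N 0 0.
have p0 : 0 < p by rewrite subr_gt0.
pose N' := \matrix_(i < n, j < n)
  (N (lift 0 i) (lift 0 j) + N (lift 0 i) 0 * N 0 (lift 0 j) / p).
have N'0 i j : 0 <= N' i j.
  by rewrite mxE addr_ge0 // divr_ge0 ?mulr_ge0 // ltW.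
have row_split i : N i 0 + \sum_j N i (lift 0 j) <= 1.
  by rewrite -(big_ord_recl _ (N i)) N1.
have row0 : \sum_j N 0 (lift 0 j) <= p by rewrite lerBrDl.
have N'1 i : \sum_j N' i j <= 1.
  under eq_bigr do rewrite mxE.
  rewrite big_split /= -mulr_suml -mulr_sumr.
  apply: le_trans (row_split (lift 0 i)); rewrite addrC lerD2r.
  by rewrite -mulrA ler_piMr // ler_pdivrMr // mul1r.
have rk : ((\rank (1%:M - N')%R).+1 <= \rank (1%:M - N)%R)%N.
  have a0 : (1%:M - N) 0 0 != 0 by rewrite !mxE /= lt0r_neq0.
  have := @mxrank_schur n (1%:M - N) a0; congr (\rank _ < _)%N.
  apply/matrixP => i j; rewrite !mxE big_ord1 !mxE /=.
  have -> : lshift n (0 : 'I_1) = 0 :> 'I_(1 + n) by apply/val_inj.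
  have E (l : 'I_n) : rshift 1 l = lift 0 l by apply/val_inj.
  rewrite !E (inj_eq (@lift_inj _ 0)).
  rewrite /p /=; field; exact: lt0r_neq0.
have [/forallP N'd|/forallPn[i0]] := boolP [forall i, N' i i < 1].
  have := IHk _ N' le_nk N'0 N'1 N'd; lia.
rewrite -leNgt => Ni0.
have pivot i : 1 <= N' i i -> p <= N 0 (lift 0 i).
  rewrite mxE => h; rewrite leNgt; apply/negP => lt_p.
  have Ni0ge := N0 (lift 0 i) 0.
  have le1 : N (lift 0 i) (lift 0 i) + N (lift 0 i) 0 <= 1.
    apply: le_trans (row_split (lift 0 i)); rewrite addrC lerD2l.
    by rewrite (bigD1 i) //= lerDl sumr_ge0.
  have Nii := Nd (lift 0 i).
  have : N (lift 0 i) 0 * N 0 (lift 0 i) / p <= N (lift 0 i) 0.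
    by rewrite -mulrA ler_piMr // ler_pdivrMr // mul1r ltW.
  move: Ni0ge; rewrite le_eqVlt => /predU1P[E|Npos]; first by move: h; rewrite -E; lra.
  have : N (lift 0 i) 0 * N 0 (lift 0 i) / p < N (lift 0 i) 0.
    by rewrite -mulrA gtr_pMr // ltr_pdivrMr // mul1r.
  lra.
case: n => [|n] in N le_nk N0 N1 Nd p p0 N' N'0 row_split row0 N'1 rk i0 Ni0 pivot *.
  by case: i0 {Ni0}.
pose N'' := \matrix_(i, j) N' (lift i0 i) (lift i0 j).
have rk2 : (\rank (1%:M - N'')%R <= \rank (1%:M - N')%R)%N.
  have -> : 1%:M - N'' = rowsub (lift i0) (colsub (lift i0) (1%:M - N')).
    by apply/matrixP => i j; rewrite !mxE (inj_eq (@lift_inj _ i0)).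
  apply: leq_trans (mxrankS (rowsub_sub _ _)) _.
  by rewrite -[X in colsub _ X]mulmx1 -mulmx_colsub mxrankM_maxl.
have : (n <= 2 * \rank (1%:M - N'')%R)%N.
  apply: IHk; first exact: ltnW.
  - by move=> i j; rewrite mxE.
  - move=> i; apply: le_trans (N'1 (lift i0 i)).
    under eq_bigr do rewrite mxE.
    by rewrite [leRHS](bigD1_ord i0) //= lerDr N'0.
  - move=> i; rewrite mxE ltNge; apply/negP => /pivot h; have h0 := pivot _ Ni0.
    have : N 0 (lift 0 i0) + N 0 (lift 0 (lift i0 i)) <= p.
      apply: le_trans row0; rewrite [leRHS](bigD1_ord i0) //= lerD2l.
      by rewrite (bigD1 i) //= lerDl sumr_ge0.
    lra.
lia.
Qed.

Lemma weighted_incidence_count (I J : finType) (lam : I -> R) (mu : J -> R)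
    (a : I -> J -> R) :
  (forall i, 0 <= lam i) -> (forall j, 0 <= mu j) ->
  (forall i j, a i j = 0 \/ 1 <= a i j) ->
  (forall j, \sum_i lam i * a i j = 1) -> (forall i, \sum_j mu j * a i j = 1) ->
  3 * \sum_i lam i <= #|I|%:R + #|J|%:R +
    #|[pred i | (2^-1 < lam i) && (#|[pred j | a i j != 0%R]| == 1)%N]|%:R.
Proof.
move=> lam0 mu0 aP lam1 mu1.
have a0 i j : 0 <= a i j by case: (aP i j) => [->|/(le_trans ler01)].
have a1 i j : a i j != 0 -> 1 <= a i j by case: (aP i j) => [->|//]; rewrite eqxx.
have tot : \sum_i lam i = \sum_j mu j.
  transitivity (\sum_i \sum_j lam i * a i j * mu j).
    apply: eq_bigr => i _; rewrite -[LHS]mulr1 -(mu1 i) mulr_sumr.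
    by apply: eq_bigr => j _; rewrite -mulrA [a i j * _]mulrC.
  rewrite exchange_big; apply: eq_bigr => j _ /=.
  by rewrite -mulr_suml lam1 mul1r.
have lam_le1 i : lam i <= 1.
  have [j aij|/= none] := pickP (fun j => a i j != 0).
    apply: le_trans (_ : lam i * a i j <= 1); first by rewrite ler_peMr ?a1.
    by rewrite -(lam1 j) (bigD1 i) //= lerDl sumr_ge0 // => k _; rewrite mulr_ge0.
  have := mu1 i; rewrite big1 => [/esym/eqP|j _]; first by rewrite oner_eq0.
  by have /eqP-> := negbFE (none j); rewrite mulr0.
have mu_le1 j : mu j <= 1.
  have [i aij|/= none] := pickP (fun i => a i j != 0).
    apply: le_trans (_ : mu j * a i j <= 1); first by rewrite ler_peMr ?a1.
    by rewrite -(mu1 i) (bigD1 j) //= lerDl sumr_ge0 // => k _; rewrite mulr_ge0.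
  have := lam1 j; rewrite big1 => [/esym/eqP|i _]; first by rewrite oner_eq0.
  by have /eqP-> := negbFE (none i); rewrite mulr0.
pose B i := 2^-1 < lam i.
have uniqB j i i' : B i -> B i' -> a i j != 0 -> a i' j != 0 -> i = i'.
  move=> Bi Bi' ai ai'; apply/eqP/negPn/negP => ne.
  have := lam1 j; rewrite (bigD1 i) //= (bigD1 i') /=; last by rewrite eq_sym.
  have : 0 <= \sum_(k | (k != i) && (k != i')) lam k * a k j.
    by apply: sumr_ge0 => k _; rewrite mulr_ge0.
  have : lam i <= lam i * a i j by rewrite ler_peMr ?a1.
  have : lam i' <= lam i' * a i' j by rewrite ler_peMr ?a1.
  rewrite /B in Bi Bi'; lra.
pose c i := #|[pred j | a i j != 0]|.
have half : 2 * \sum_i lam i <= #|I|%:R + #|[pred i | B i]|%:R.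
  rewrite -sum1_card -sum1_card !natr_sum [X in _ + X]big_mkcond -big_split mulr_sumr /=.
  apply: ler_sum => i _; have := lam_le1 i; rewrite inE /B.
  by case: ifP => [|/negbT]; rewrite -?leNgt; lra.
have defect : \sum_(i | B i) ((c i)%:R - 1) <= #|J|%:R - \sum_j mu j.
  have -> : #|J|%:R - \sum_j mu j = \sum_j (1 - mu j).
    by rewrite sumrB -sum1_card natr_sum.
  apply: le_trans (_ : \sum_(i | B i) \sum_(j | a i j != 0) (1 - mu j) <= _).
    apply: ler_sum => i Bi; rewrite sumrB.
    have -> : \sum_(j | a i j != 0) 1 = (c i)%:R :> R.
      by rewrite /c -sum1_card natr_sum; apply: eq_bigl.
    rewrite lerD2l lerN2.
    rewrite -(mu1 i) big_mkcond ler_sum // => j _.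
    by case: ifP => [/a1 h|_]; rewrite ?ler_peMr ?mulr_ge0.
  rewrite (exchange_big_dep xpredT) //=; apply: ler_sum => j _.
  have [i /andP[Bi aij]|none] := pickP (fun i => B i && (a i j != 0)).
    rewrite (big_pred1 i) // => k /=; apply/andP/eqP => [[Bk ak]|->//].
    exact: (uniqB j).
  by rewrite big_pred0 // subr_ge0.
have c0 i : (0 < c i)%N.
  rewrite lt0n; apply/negP => /eqP/card0_eq none.
  have := mu1 i; rewrite big1 => [/esym/eqP|j _]; first by rewrite oner_eq0.
  by have := none j; rewrite !inE => /negbFE/eqP->; rewrite mulr0.
have split : #|[pred i | B i]|%:R <=
    #|[pred i | B i && (c i == 1)%N]|%:R + \sum_(i | B i) ((c i)%:R - 1) :> R.
  rewrite -!sum1_card !natr_sum big_mkcond [X in X + _]big_mkcond.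
  rewrite [X in _ + X]big_mkcond -big_split /=.
  apply: ler_sum => i _; rewrite !inE; case: ifP => _ /=; last by rewrite addr0.
  have := c0 i; case: (c i) => [|[|k]] //= _; first by rewrite subrr addr0.
  by rewrite add0r lerBrDr -(natrD _ 1 1) ler_nat.
rewrite -tot in defect; rewrite /B /c in split half defect *; lra.
Qed.

End SubstochasticMatrices.

Section PositiveCone.
Variables (R : realFieldType) (n : nat) (C : 'M[R]_n) (theta : 'I_n -> R).
Local Open Scope ring_scope.
Implicit Types z F G : 'rV[R]_n.

Definition weight z := \sum_i theta i * z 0 i.

(* The row space of [C] plays the role of the space of affine functionals,
   each recorded by its values at n points: facets are the functionals that are
   nonnegative and of minimal support. *)
Definition facet_vector z := [/\ (z <= C)%MS, forall i, 0 <= z 0 i, weight z = 1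
  & forall z', (z' <= C)%MS -> (forall i, z 0 i = 0 -> z' 0 i = 0) ->
      exists k, z' = k *: z].

Lemma weightZ k z : weight (k *: z) = k * weight z.
Proof. by rewrite /weight mulr_sumr; apply: eq_bigr => i _; rewrite mxE mulrCA. Qed.

Lemma facet_vector_inj F G : facet_vector F -> facet_vector G ->
  (forall i, F 0 i = 0 -> G 0 i = 0) -> G = F.
Proof.
move=> [_ _ wF minF] [CG _ wG _] /(minF _ CG)[k Gk].
by move: wG; rewrite Gk weightZ wF mulr1 => ->; rewrite scale1r.
Qed.

Lemma caratheodory (p : 'rV[R]_n -> Prop) k (Z : 'M[R]_(k, n)) (nu : 'rV_k) :
  (forall i, p (row i Z)) -> (forall i, 0 <= nu 0 i) ->
  exists k' (Z' : 'M[R]_(k', n)) (nu' : 'rV_k'),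
    [/\ forall i, p (row i Z'), forall i, 0 < nu' 0 i, row_free Z'
      & nu' *m Z' = nu *m Z].
Proof.
elim: k Z nu => [|k IHk] Z nu pZ nu0.
  by exists 0, Z, nu; split => //; [case | rewrite /row_free -leqn0 rank_leq_row].
have drop (nu1 : 'rV_k.+1) i0 : (forall i, 0 <= nu1 0 i) -> nu1 0 i0 = 0 ->
    nu1 *m Z = nu *m Z -> exists k' (Z' : 'M[R]_(k', n)) (nu' : 'rV_k'),
    [/\ forall i, p (row i Z'), forall i, 0 < nu' 0 i, row_free Z'
      & nu' *m Z' = nu *m Z].
  move=> nu10 nu1i0 <-.
  have [||k' [Z' [nu' [pZ' nu'0 fZ' eZ']]]] := IHk (row' i0 Z) (col' i0 nu1).
  - move=> i; suff -> : row i (row' i0 Z) = row (lift i0 i) Z by [].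
    by apply/rowP => j; rewrite !mxE.
  - by move=> i; rewrite mxE.
  exists k', Z', nu'; split => //; rewrite eZ'.
  apply/rowP => j; rewrite !mxE [RHS](bigD1_ord i0) //= nu1i0 mul0r add0r.
  by apply: eq_bigr => i _; rewrite !mxE.
have [i /eqP nui|/= nuN0] := pickP (fun i => nu 0 i == 0); first exact: (drop nu i).
have nu_gt0 i : 0 < nu 0 i by rewrite lt_neqAle nu0 eq_sym nuN0.
have [fZ|nfZ] := boolP (row_free Z); first by exists k.+1, Z, nu.
have [ka /sub_kermxP kaZ [i1 kai1]] :
    exists2 ka : 'rV_k.+1, (ka <= kermx Z)%MS & exists i, 0 < ka 0 i.
  move: nfZ; rewrite -kermx_eq0 => /rowV0Pn[ka kaZ /rV0Pn[i kai]].
  have [lt0|gt0|eq0] := ltgtP (ka 0 i) 0; last by rewrite eq0 eqxx in kai.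
    exists (- ka); first by rewrite eqmx_opp.
    by exists i; rewrite mxE oppr_gt0.
  by exists ka => //; exists i.
pose ratio i := nu 0 i / ka 0 i.
case: (@arg_minP _ _ _ i1 (fun i => 0 < ka 0 i) ratio kai1) => i0 kai0 min_i0.
apply: (drop (nu - ratio i0 *: ka) i0).
- move=> i; rewrite !mxE subr_ge0.
  have [kai|kai] := ltP 0 (ka 0 i); first by rewrite -ler_pdivlMr ?min_i0.
  apply: le_trans (ltW (nu_gt0 i)).
  by rewrite mulr_ge0_le0 // divr_ge0 // ltW.
- by rewrite !mxE divfK ?subrr // gt_eqF.
- by rewrite mulmxBl -scalemxAl kaZ scaler0 subr0.
Qed.

Hypothesis theta_gt0 : forall i, 0 < theta i.

Lemma weight_gt0 z : (forall i, 0 <= z 0 i) -> z != 0 -> 0 < weight z.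
Proof.
move=> z0 /rV0Pn[i zi]; rewrite /weight (bigD1 i) //= ltr_pwDl //.
  by rewrite mulr_gt0 // lt_neqAle eq_sym zi z0.
by apply: sumr_ge0 => j _; rewrite mulr_ge0 // ltW.
Qed.

Lemma facet_decomposition z : (z <= C)%MS -> (forall i, 0 <= z 0 i) ->
  exists k (Z : 'M[R]_(k, n)) (nu : 'rV_k),
    [/\ forall i, facet_vector (row i Z), forall i, 0 <= nu 0 i & z = nu *m Z].
Proof.
have [N] := ubnP #|[pred i | z 0 i != 0]|; elim: N z => // N IHN z.
rewrite ltnS => leN Cz z0.
have [->|zN0] := eqVneq z 0.
  exists 0, 0, 0; split; [by case | by case | by rewrite mulmx0].
have wz := weight_gt0 z0 zN0.
have [minz|/existsNP[z' /not_implyP[Cz' /not_implyP[sz' nz']]]] := pselect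
    (forall z', (z' <= C)%MS -> (forall i, z 0 i = 0 -> z' 0 i = 0) ->
      exists k, z' = k *: z).
  exists 1, ((weight z)^-1 *: z), (weight z)%:M; split.
  - move=> i; rewrite row_id; split.
    + exact: scalemx_sub.
    + by move=> j; rewrite mxE mulr_ge0 // invr_ge0 ltW.
    + by rewrite weightZ mulVf // gt_eqF.
    + move=> z' Cz' sz'; have [|k ->] := minz z' Cz'.
        by move=> j zj; apply: sz'; rewrite mxE zj mulr0.
      by exists (k * weight z); rewrite scalerA mulfK // gt_eqF.
  - by move=> i; rewrite !ord1 mxE mulr1n ltW.
  - by rewrite mul_scalar_mx scalerA mulfV ?scale1r // gt_eqF.
have /rV0Pn[i0 zi0] := zN0.
pose q i := z' 0 i / z 0 i.
case: (@arg_minP _ _ _ i0 (fun i => z 0 i != 0) q zi0) => i1 zi1 min1.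
case: (@arg_maxP _ _ _ i0 (fun i => z 0 i != 0) q zi0) => i2 zi2 max2'.
have max2 i : z 0 i != 0 -> q i <= q i2 := max2' i.
have z_gt0 i : z 0 i != 0 -> 0 < z 0 i by rewrite lt_neqAle z0 eq_sym andbT.
have lt12 : q i1 < q i2.
  rewrite ltNge; apply/negP => le21; apply: nz'; exists (q i1).
  apply/rowP => i; rewrite mxE.
  have [zi|zi] := eqVneq (z 0 i) 0; first by rewrite zi mulr0 sz'.
  suff -> : q i1 = q i by rewrite divfK.
  by apply/eqP; rewrite eq_le min1 //= (le_trans (max2 _ zi)).
pose a := z' - q i1 *: z; pose b := q i2 *: z - z'.
have sub (c : 'rV[R]_n) i : (c <= C)%MS -> (forall i, 0 <= c 0 i) ->
    (forall i, z 0 i = 0 -> c 0 i = 0) -> z 0 i != 0 -> c 0 i = 0 ->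
    exists k (Z : 'M[R]_(k, n)) (nu : 'rV_k),
    [/\ forall i, facet_vector (row i Z), forall i, 0 <= nu 0 i & c = nu *m Z].
  move=> Cc c0 sc zi ci; apply: IHN => //; apply: leq_trans leN.
  apply/proper_card/properP; split; last by exists i; rewrite !inE // ci eqxx.
  by apply/fintype.subsetP => j; rewrite !inE; apply: contra_neq => /sc.
have [||||ka [Za [nua [fZa nua0 ea]]]] := @sub a i1 _ _ _ zi1.
- by rewrite addmx_sub // eqmx_opp scalemx_sub.
- move=> i; rewrite !mxE subr_ge0.
  have [zi|zi] := eqVneq (z 0 i) 0; first by rewrite zi mulr0 sz'.
  by rewrite -ler_pdivlMr ?z_gt0 // min1.
- by move=> i zi; rewrite !mxE zi sz' // mulr0 subrr.
- by rewrite !mxE divfK // subrr.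
have [||||kb [Zb [nub [fZb nub0 eb]]]] := @sub b i2 _ _ _ zi2.
- by rewrite addmx_sub ?scalemx_sub // eqmx_opp.
- move=> i; rewrite !mxE subr_ge0.
  have [zi|zi] := eqVneq (z 0 i) 0; first by rewrite zi mulr0 sz'.
  by rewrite -ler_pdivrMr ?z_gt0 // max2.
- by move=> i zi; rewrite !mxE zi sz' // mulr0 subrr.
- by rewrite !mxE divfK // subrr.
exists (ka + kb)%N, (col_mx Za Zb), ((q i2 - q i1)^-1 *: row_mx nua nub).
have q0 : 0 < q i2 - q i1 by rewrite subr_gt0.
split.
- move=> i; case: (split_ordP i) => j ->.
    suff -> : row (lshift kb j) (col_mx Za Zb) = row j Za by [].
    by apply/rowP => l; rewrite !mxE (unsplitK (inl j)).
  suff -> : row (rshift ka j) (col_mx Za Zb) = row j Zb by [].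
  by apply/rowP => l; rewrite !mxE (unsplitK (inr j)).
- move=> i; rewrite mxE mulr_ge0 ?invr_ge0 ?(ltW q0) // mxE.
  by case: fintype.splitP.
- have ab : a + b = (q i2 - q i1) *: z.
    by rewrite scalerBl [LHS]addrC /a /b addrA subrK.
  by rewrite -scalemxAl mul_row_col -ea -eb ab scalerA mulVf ?scale1r // gt_eqF.
Qed.

Hypothesis one_in_C : ((const_mx 1 : 'rV[R]_n) <= C)%MS.
Hypothesis C_separates :
  forall v w, (forall z, (z <= C)%MS -> z 0 v = z 0 w) -> v = w.

Lemma unique_facet_delta F v : facet_vector F -> F 0 v = 1 ->
  (forall w, F 0 w = 0 \/ 1 <= F 0 w) ->
  (forall G, facet_vector G -> G 0 v != 0 -> G = F) -> F = delta_mx 0 v.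
Proof.
move=> fF Fv Fint Funiq.
have ge z w : (z <= C)%MS -> (forall i, 0 <= z 0 i) -> z 0 v * F 0 w <= z 0 w.
  move=> Cz /(facet_decomposition Cz)[k [Z [nu [fZ nu0 ->]]]].
  rewrite !mxE mulr_suml ler_sum // => i _; rewrite -mulrA ler_wpM2l //.
  have [zv|zv] := eqVneq (Z i v) 0.
    by rewrite zv mul0r; case: (fZ i) => _ /(_ w); rewrite mxE.
  have rF : row i Z = F by apply: Funiq => //; rewrite mxE.
  have -> : Z i v = F 0 v by rewrite -rF mxE.
  have -> : Z i w = F 0 w by rewrite -rF mxE.
  by rewrite Fv mul1r.
have F01 w : F 0 w = 0 \/ F 0 w = 1.
  case: (Fint w) => [|Fw]; [by left | right; apply/eqP; rewrite eq_le Fw andbT].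
  have := @ge (const_mx 1) w one_in_C; rewrite !mxE mul1r; apply.
  by move=> i; rewrite mxE.
apply/rowP => w; rewrite mxE /=; case: (F01 w) => Fw; rewrite Fw.
  by case: eqP => // wv; move: Fw; rewrite wv Fv => /eqP; rewrite oner_eq0.
have mono z : (z <= C)%MS -> z 0 v <= z 0 w.
  move=> Cz; pose e := (1 + \sum_i `|z 0 i|)^-1.
  have s0 : 0 <= \sum_i `|z 0 i| by apply: sumr_ge0.
  have e0 : 0 < e by rewrite invr_gt0; lra.
  have := @ge (const_mx 1 + e *: z) w; rewrite Fw mulr1 !mxE lerD2l ler_pM2l //.
  apply; first by rewrite addmx_sub ?scalemx_sub.
  move=> i; rewrite !mxE.
  have : e * `|z 0 i| <= 1.
    rewrite mulrC ler_pdivrMr ?mul1r; last lra.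
    by rewrite (bigD1 i) //= addrCA lerDl addr_ge0 // sumr_ge0.
  have : - (e * z 0 i) <= e * `|z 0 i| by rewrite -mulrN ler_pM2l // lerNl lerNnormlW.
  lra.
suff -> : v = w by rewrite eqxx.
apply: C_separates => z Cz; apply/eqP; rewrite eq_le mono //=.
by rewrite -lerN2; have := @mono (- z); rewrite eqmx_opp !mxE; apply.
Qed.

Lemma facet_pairs_rank g (F G : 'M[R]_(g, n)) :
  (forall i, facet_vector (row i F)) -> (forall i, facet_vector (row i G)) ->
  (forall i, row i G <> row i F) ->
  (forall i w, F i w = 0 \/ F i w = 1) ->
  (forall i j w, i != j -> F i w = 0 \/ F j w = 0) ->
  (g <= 2 * \rank ((F - G) *m \matrix_(w, i) (theta w * F i w))%R)%N.
Proof.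
move=> fF fG neGF F01 Fdisj; set P := \matrix_(w, i) _.
have G0 i w : 0 <= G i w by case: (fG i) => _ /(_ w); rewrite mxE.
have F0 i w : 0 <= F i w by case: (F01 i w) => ->.
have FP : F *m P = 1%:M.
  apply/matrixP => i j; rewrite !mxE; have [->|ne] := eqVneq i j.
    case: (fF j) => _ _ <- _; apply: eq_bigr => w _; rewrite !mxE.
    by case: (F01 j w) => ->; rewrite !(mulr0, mulr1, mul1r, mul0r).
  rewrite big1 // => w _; rewrite mxE.
  by case: (Fdisj i j w ne) => ->; rewrite ?mul0r ?mulr0.
have Gw i : \sum_w theta w * G i w = 1.
  by case: (fG i) => _ _ <- _; apply: eq_bigr => w _; rewrite mxE.
rewrite mulmxBl FP; apply: substochastic_rank.
- move=> i j; rewrite mxE sumr_ge0 // => w _; rewrite mxE !mulr_ge0 //.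
  exact: ltW.
- move=> i; under eq_bigr do rewrite mxE.
  rewrite exchange_big -(Gw i) ler_sum // => w _ /=.
  under eq_bigr do rewrite mxE mulrA.
  rewrite -mulr_sumr mulrC [X in X <= _]mulrC -[leRHS]mulr1 mulrC [G i w * _]mulrC.
  rewrite [X in X <= _]mulrC ler_wpM2l ?mulr_ge0 ?(ltW (theta_gt0 w)) //.
  have [j Fj|/= none] := pickP (fun j => F j w != 0); last first.
    by rewrite big1 // => j _; apply/eqP/negbFE/none.
  rewrite (bigD1 j) //= big1 ?addr0; first by case: (F01 j w) => ->.
  move=> l lj; case: (Fdisj l j w lj) => // Fjw.
  by rewrite Fjw eqxx in Fj.
move=> i; rewrite ltNge; apply/negP => ge1.
apply: (neGF i); apply: facet_vector_inj => // w; rewrite !mxE => Fw.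
have : \sum_w theta w * G i w * (1 - F i w) <= 0.
  rewrite (_ : \sum_w _ = 1 - (G *m P) i i) ?subr_le0 //.
  rewrite -[1 in RHS](Gw i) mxE -sumrB; apply: eq_bigr => u _; rewrite mxE; ring.
have pos u : 0 <= theta u * G i u * (1 - F i u).
  rewrite !mulr_ge0 ?(ltW (theta_gt0 u)) // subr_ge0.
  by case: (F01 i u) => ->.
rewrite (bigD1 w) //= Fw subr0 mulr1 => le0.
have : theta w * G i w <= 0.
  by apply: le_trans le0; rewrite lerDl sumr_ge0.
rewrite pmulr_rle0 // => Gle; apply/eqP; rewrite eq_le Gle; exact: G0.
Qed.

End PositiveCone.

Section PyramidFunctional.
Variables (R : realFieldType) (n : nat) (C : 'M[R]_n) (theta : 'I_n -> R).
Local Open Scope ring_scope.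
Local Notation facet_vector := (facet_vector C theta).

Theorem exists_delta_facet (r s : nat) :
  (forall i, 0 < theta i) -> ((const_mx 1 : 'rV[R]_n) <= C)%MS ->
  (forall v w, (forall z : 'rV_n, (z <= C)%MS -> z 0 v = z 0 w) -> v = w) ->
  (forall F i, facet_vector F -> [\/ F 0 i = 0, F 0 i = 1 | 2 <= F 0 i]) ->
  \sum_i theta i = r%:R -> (\rank C <= s + r)%N -> (3 * s < \rank C)%N ->
  exists v, facet_vector (delta_mx 0 v).
Proof.
move=> theta0 C1 Csep Fint sum_theta le_s lt_s; apply: contrapT => /forallNP noD.
have F0 F i : facet_vector F -> 0 <= F 0 i by case.
have F_ge1 F i : facet_vector F -> F 0 i != 0 -> 1 <= F 0 i.
  move=> fF; case: (Fint F i fF) => [->|->|]; rewrite ?eqxx //.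
  by move=> h _; lra.
have F_eq1 F i : facet_vector F -> F 0 i != 0 -> F 0 i < 2 -> F 0 i = 1.
  move=> fF; case: (Fint F i fF) => [->|//|]; rewrite ?eqxx //.
  by move=> h _; rewrite ltNge h.
have other v F : facet_vector F -> F 0 v = 1 ->
    exists G, [/\ facet_vector G, G 0 v != 0 & G <> F].
  move=> fF Fv; apply: contrapT => /forallNP noG; apply: (noD v).
  suff <- : F = delta_mx 0 v by [].
  apply: (unique_facet_delta theta0 C1 Csep fF) => // [w|G fG Gv].
    by have [|/(F_ge1 _ _ fF)] := eqVneq (F 0 w) 0; [left | right].
  by apply: contrapT => neGF; apply: (noG G).
have [k0 [Z0 [mu0 [fZ0 mu0_ge0 Z01]]]] := facet_decomposition theta0 C1
  (fun i => ltac:(by rewrite mxE)).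
have [k2 [Z [mu [fZ mu_gt0 freeZ muZ]]]] := caratheodory fZ0 mu0_ge0.
rewrite -{}Z01 {k0 Z0 mu0 fZ0 mu0_ge0} in muZ.
have [||k1 [E [lam [Erow lam_gt0 freeE lamE]]]] :=
  @caratheodory R n (fun e => exists i, e = row i C^T) n C^T (\row_i theta i).
- by move=> i; exists i.
- by move=> i; rewrite mxE ltW.
have [idx idxP] := choice Erow.
have lam_eval (F : 'rV_n) : (F <= C)%MS ->
    \sum_i lam 0 i * F 0 (idx i) = weight theta F.
  case/submxP=> y ->; have := congr1 (fun e => (e *m y^T) 0 0) lamE.
  rewrite -!mulmxA -trmx_mul !mxE => eqE.
  rewrite /weight; transitivity (\sum_j (\row_i theta i) 0 j * (y *m C)^T j 0).
    rewrite -eqE; apply: eq_bigr => i _; congr (_ * _); rewrite !mxE.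
    apply: eq_bigr => l _; have /rowP/(_ l) := idxP i; rewrite !mxE => ->.
    by rewrite mulrC.
  by apply: eq_bigr => j _; rewrite !mxE.
have lamF F : facet_vector F -> \sum_i lam 0 i * F 0 (idx i) = 1.
  by case=> CF _ wF _; rewrite lam_eval.
have muw w : \sum_j mu 0 j * Z j w = 1.
  by have /rowP/(_ w) := muZ; rewrite !mxE.
have sum_lam : \sum_i lam 0 i = r%:R.
  rewrite -sum_theta; have := lam_eval _ C1; rewrite /weight => e.
  transitivity (\sum_i lam 0 i * (const_mx 1 : 'rV[R]_n) 0 (idx i)).
    by apply: eq_bigr => i _; rewrite mxE mulr1.
  by rewrite e; apply: eq_bigr => i _; rewrite mxE mulr1.
pose a i j := Z j (idx i).
have rowZ j w : (row j Z) 0 w = Z j w by rewrite mxE.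
have aP i j : a i j = 0 \/ 1 <= a i j.
  rewrite /a -rowZ; have [|/(F_ge1 _ _ (fZ j))] := eqVneq (row j Z 0 (idx i)) 0.
    by left.
  by right.
have alam j : \sum_i lam 0 i * a i j = 1.
  by rewrite -(lamF _ (fZ j)); apply: eq_bigr => i _; rewrite rowZ.
have amu i : \sum_j mu 0 j * a i j = 1 by exact: muw.
have sum_mu : \sum_j mu 0 j = r%:R.
  transitivity (\sum_j mu 0 j * \sum_i lam 0 i * a i j).
    by apply: eq_bigr => j _; rewrite alam mulr1.
  under eq_bigr do rewrite mulr_sumr.
  rewrite exchange_big -sum_lam; apply: eq_bigr => i _ /=.
  rewrite -[RHS]mulr1 -(amu i) mulr_sumr; apply: eq_bigr => j _; ring.
have lam0 i : 0 <= lam 0 i by rewrite ltW.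
have mu0 j : 0 <= mu 0 j by rewrite ltW.
have CZ : (Z <= C)%MS by apply/row_subP => j; case: (fZ j).
have two_terms k (nu c : 'I_k -> R) i i' : (forall j, 0 <= nu j) ->
    (forall j, 0 <= c j) -> \sum_j nu j * c j = 1 -> i != i' ->
    nu i * c i + nu i' * c i' <= 1.
  move=> nu0 c0 <- ne; rewrite (bigD1 i) //= lerD2l (bigD1 i') /= 1?eq_sym //.
  by rewrite lerDl sumr_ge0 // => j _; rewrite mulr_ge0.
have one_term k (nu c : 'I_k -> R) i : (forall j, 0 <= nu j) ->
    (forall j, 0 <= c j) -> \sum_j nu j * c j = 1 -> nu i * c i <= 1.
  move=> nu0 c0 <-; rewrite (bigD1 i) //= lerDl sumr_ge0 // => j _.
  by rewrite mulr_ge0.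
have only_term k (nu c : 'I_k -> R) i : \sum_j nu j * c j = 1 ->
    (forall j, j != i -> c j = 0) -> nu i * c i = 1.
  by move=> <- c0; rewrite [RHS](bigD1 i) //= big1 ?addr0 // => j /c0->; rewrite mulr0.
(* Generators with [lam > 1/2] lie off pairwise disjoint sets of facets, and
   likewise for facets with [mu > 1/2]; this makes the pairs below disjoint. *)
have [le12|lt21] := leqP k1 k2.
  have := weighted_incidence_count lam0 mu0 aP alam amu.
  rewrite !card_ord sum_lam; set B0 := [pred i | _].
  rewrite -!natrD -(natrM _ 3) ler_nat => count.
  pose sg (t : 'I_#|B0|) := enum_val t.
  have sgB t : 2^-1 < lam 0 (sg t) by have := enum_valP t; rewrite inE => /andP[].
  have /choice[jt jtP] : forall t, exists j, forall j', (a (sg t) j' != 0) = (j' == j).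
    move=> t; have := enum_valP t; rewrite inE => /andP[_ /eqP/mem_card1[j jP]].
    by exists j => j'; have := jP j'; rewrite !inE.
  have Fv t : Z (jt t) (idx (sg t)) = 1.
    rewrite -rowZ; apply: F_eq1 => //; first by rewrite rowZ jtP.
    have fJ := fZ (jt t).
    have := one_term _ _ _ (sg t) lam0 (fun i => F0 _ (idx i) fJ) (lamF _ fJ).
    have := F0 _ (idx (sg t)) fJ; have := sgB t; nra.
  have mu1 t : mu 0 (jt t) = 1.
    rewrite -[LHS]mulr1 -{1}(Fv t); apply: only_term (amu (sg t)) _ => j.
    by rewrite -jtP negbK => /eqP.
  have /choice[Gf GfP] := fun t => other _ _ (fZ (jt t)) (etrans (rowZ _ _) (Fv t)).
  have sep_v G t t' : facet_vector G -> G 0 (idx (sg t)) != 0 -> t' != t ->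
      G 0 (idx (sg t')) = 0.
    move=> fG Gt net; apply/eqP/negPn/negP => Gt'.
    have net2 : sg t' != sg t by rewrite (inj_eq enum_val_inj).
    have := two_terms _ _ _ _ _ lam0 (fun i => F0 _ (idx i) fG) (lamF _ fG) net2.
    have := F_ge1 _ _ fG Gt; have := F_ge1 _ _ fG Gt'; have := sgB t; have := sgB t'.
    nra.
  have Gv t : Gf t 0 (idx (sg t)) = 1.
    have [fG Gt _] := GfP t; apply: F_eq1 => //.
    have := one_term _ _ _ (sg t) lam0 (fun i => F0 _ (idx i) fG) (lamF _ fG).
    have := F0 _ (idx (sg t)) fG; have := sgB t; nra.
  have Zj t w j : Z (jt t) w != 0 -> j != jt t -> Z j w = 0.
    rewrite -!rowZ => Zt nej; apply/eqP/negPn/negP => Zw.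
    have muw' : \sum_j mu 0 j * row j Z 0 w = 1.
      by rewrite -(muw w); apply: eq_bigr => i _; rewrite rowZ.
    have := two_terms _ _ _ _ _ mu0 (fun i => F0 _ w (fZ i)) muw' nej.
    have := F_ge1 _ _ (fZ _) Zt; have := F_ge1 _ _ (fZ _) Zw.
    have := mu_gt0 j; rewrite mu1; nra.
  have Z01 t w : Z (jt t) w = 0 \/ Z (jt t) w = 1.
    have [|Zt] := eqVneq (Z (jt t) w) 0; [by left | right].
    have := only_term _ _ _ (jt t) (muw w) (fun j nej => Zj _ _ _ Zt nej).
    by rewrite mu1 mul1r.
  pose F := \matrix_(t, w) Z (jt t) w; pose G := \matrix_(t, w) Gf t 0 w.
  have rF t : row t F = row (jt t) Z by apply/rowP => w; rewrite !mxE.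
  have rG t : row t G = Gf t by apply/rowP => w; rewrite !mxE.
  have jt_inj t t' : t != t' -> jt t' != jt t.
    move=> net; apply/eqP => e; have := Fv t'; rewrite -rowZ e.
    rewrite (sep_v _ t) //; first by move/eqP; rewrite eq_sym oner_eq0.
      by rewrite rowZ Fv oner_neq0.
    by rewrite eq_sym.
  pose P := \matrix_(w, i) (theta w * F i w).
  have rk : (#|B0| <= 2 * \rank ((F - G) *m P)%R)%N.
    apply: (facet_pairs_rank theta0 (C := C)).
    - by move=> t; rewrite rF.
    - by move=> t; rewrite rG; case: (GfP t).
    - by move=> t; rewrite rF rG; case: (GfP t).
    - by move=> t w; rewrite mxE.
    - move=> t t' w net; rewrite !mxE.
      have [->|/Zj Zt] := eqVneq (Z (jt t) w) 0; first by left.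
      by right; apply/Zt/jt_inj.
  pose D : 'M[R]_(n, #|B0|) := \matrix_(w, t) (w == idx (sg t))%:R.
  have evalD k (M : 'M[R]_(k, n)) i t : (M *m D) i t = M i (idx (sg t)).
    rewrite mxE (bigD1 (idx (sg t))) //= mxE eqxx mulr1 big1 ?addr0 // => w ne.
    by rewrite mxE (negPf ne) mulr0.
  have FGP : (F - G) *m P = (F - G) *m (P - D).
    rewrite mulmxBr; suff -> : (F - G) *m D = 0 by rewrite subr0.
    apply/matrixP => t' t; rewrite evalD !mxE.
    have [->|net] := eqVneq t t'; first by rewrite Fv Gv subrr.
    rewrite -rowZ (sep_v _ t') ?rowZ ?Fv ?oner_neq0 //.
    by rewrite (sep_v _ t') ?Gv ?oner_neq0 ?subrr //; case: (GfP t').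
  have ZPD : Z *m (P - D) = 0.
    apply/matrixP => j t; rewrite mulmxBr mxE [X in _ + X]mxE evalD [RHS]mxE.
    apply/eqP; rewrite subr_eq0; apply/eqP; rewrite mxE.
    have [->|nej] := eqVneq j (jt t).
      rewrite Fv; case: (fZ (jt t)) => _ _ <- _; apply: eq_bigr => w _.
      by rewrite !mxE; case: (Z01 t w) => ->; rewrite ?mulr0 ?mulr1 ?mul1r.
    have -> : Z j (idx (sg t)) = 0 by apply: Zj nej; rewrite Fv oner_neq0.
    rewrite big1 // => w _; rewrite !mxE.
    have [->|/Zj/(_ nej)->] := eqVneq (Z (jt t) w) 0; by rewrite ?mul0r ?mulr0.
  have CFG : (F - G <= C)%MS.
    apply/row_subP => t; rewrite linearB /= rF rG.
    by rewrite addmx_sub ?eqmx_opp //; [case: (fZ (jt t)) | case: (GfP t) => -[]].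
  have := mxrank_mul_ker C (P - D).
  have : (Z <= C :&: kermx (P - D))%MS by rewrite sub_capmx CZ; apply/sub_kermxP.
  move=> /mxrankS; have /eqP-> := freeZ.
  have := mxrankS (submxMr (P - D) CFG); rewrite -FGP; lia.
have := weighted_incidence_count mu0 lam0 (fun j i => aP i j) amu alam.
rewrite !card_ord sum_mu; set B0 := [pred i | _].
rewrite -!natrD -(natrM _ 3) ler_nat => count.
pose sg (t : 'I_#|B0|) := enum_val t.
have sgB t : 2^-1 < mu 0 (sg t) by have := enum_valP t; rewrite inE => /andP[].
have /choice[it itP] : forall t, exists i, forall i', (a i' (sg t) != 0) = (i' == i).
  move=> t; have := enum_valP t; rewrite inE => /andP[_ /eqP/mem_card1[j jP]].
  by exists j => j'; have := jP j'; rewrite !inE.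
have Z0 j w : 0 <= Z j w by rewrite -rowZ F0.
have Z01 t w : Z (sg t) w = 0 \/ Z (sg t) w = 1.
  have [|Zt] := eqVneq (Z (sg t) w) 0; [by left | right].
  rewrite -rowZ; apply: F_eq1; rewrite ?rowZ //.
  have := one_term _ _ _ (sg t) mu0 (Z0^~ w) (muw w).
  have := Z0 (sg t) w; have := sgB t; nra.
have Fv t : Z (sg t) (idx (it t)) = 1.
  have : a (it t) (sg t) != 0 by rewrite itP.
  by rewrite /a; case: (Z01 t (idx (it t))) => ->; rewrite ?eqxx.
have lam1 t : lam 0 (it t) = 1.
  rewrite -[LHS]mulr1 -{1}(Fv t); apply: only_term (alam (sg t)) _ => i.
  by rewrite -itP negbK => /eqP.
have /choice[Gf GfP] := fun t => other _ _ (fZ (sg t)) (etrans (rowZ _ _) (Fv t)).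
have Gv t i : i != it t -> Gf t 0 (idx i) = 0.
  have [fG Gt _] := GfP t => nei; apply/eqP/negPn/negP => Gi.
  have := two_terms _ _ _ _ _ lam0 (fun i => F0 _ (idx i) fG) (lamF _ fG) nei.
  have := F_ge1 _ _ fG Gt; have := F_ge1 _ _ fG Gi; have := lam_gt0 i.
  rewrite lam1; nra.
have Gv1 t : Gf t 0 (idx (it t)) = 1.
  have [fG _ _] := GfP t; have := only_term _ _ _ (it t) (lamF _ fG) (Gv t).
  by rewrite lam1 mul1r.
pose F := \matrix_(t, w) Z (sg t) w; pose G := \matrix_(t, w) Gf t 0 w.
have rF t : row t F = row (sg t) Z by apply/rowP => w; rewrite !mxE.
have rG t : row t G = Gf t by apply/rowP => w; rewrite !mxE.
pose P := \matrix_(w, i) (theta w * F i w).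
have rk : (#|B0| <= 2 * \rank ((F - G) *m P)%R)%N.
  apply: (facet_pairs_rank theta0 (C := C)).
  - by move=> t; rewrite rF.
  - by move=> t; rewrite rG; case: (GfP t).
  - by move=> t; rewrite rF rG; case: (GfP t).
  - by move=> t w; rewrite mxE.
  - move=> t t' w net; rewrite !mxE.
    case: (Z01 t w) => Zt; [by left | case: (Z01 t' w) => Zt'; [by right | exfalso]].
    have net2 : sg t != sg t' by rewrite (inj_eq enum_val_inj).
    have := two_terms _ _ _ _ _ mu0 (Z0^~ w) (muw w) net2.
    rewrite Zt Zt'; have := sgB t; have := sgB t'; lra.
pose D : 'M[R]_(n, k1) := \matrix_(w, i) (w == idx i)%:R.
have evalD k (M : 'M[R]_(k, n)) i t : (M *m D) i t = M i (idx t).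
  rewrite mxE (bigD1 (idx t)) //= mxE eqxx mulr1 big1 ?addr0 // => w ne.
  by rewrite mxE (negPf ne) mulr0.
have FGD : (F - G) *m D = 0.
  apply/matrixP => t i; rewrite evalD !mxE.
  have [->|nei] := eqVneq i (it t); first by rewrite Fv Gv1 subrr.
  rewrite Gv // subr0; apply/eqP; move: nei; rewrite -itP negbK; exact.
have rkD : \rank (C *m D) = k1.
  have -> : C *m D = E^T.
    apply/matrixP => l i; rewrite evalD mxE.
    by have /rowP/(_ l) := idxP i; rewrite !mxE.
  by rewrite mxrank_tr; apply/eqP.
have CFG : (F - G <= C :&: kermx D)%MS.
  rewrite sub_capmx; apply/andP; split; last exact/sub_kermxP.
  apply/row_subP => t; rewrite linearB /= rF rG.
  by rewrite addmx_sub ?eqmx_opp //; [case: (fZ (sg t)) | case: (GfP t) => -[]].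
have := leq_trans (mxrankM_maxl (F - G) P) (mxrankS CFG).
rewrite -(leq_pmul2l (isT : 0 < 2)%N) => /(leq_trans rk).
by have := mxrank_mul_ker C D; rewrite rkD; lia.
Qed.

End PyramidFunctional.

Section Hulls.
Variable R : realType.
Local Open Scope classical_set_scope.
Local Open Scope ring_scope.

Section FixedDimension.
Variable m : nat.
Local Notation E := 'rV[R]_m.

Lemma affine_combination (V : lmodType R) (A : set E) (f : E -> V) n
    (x : 'I_n -> E) (k : 'I_n -> R) :
  affine_set A -> affine_on A f -> (forall i, A (x i)) -> \sum_i k i = 1 ->
  A (\sum_i k i *: x i) /\ f (\sum_i k i *: x i) = \sum_i k i *: f (x i).
Proof.
case: n x k => [x k _ _ _|n x k Aaff faff Ax k1].
  by rewrite big_ord0 => /eqP; rewrite eq_sym oner_eq0.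
pose x0 := x ord0; pose P v y := A (x0 + v) /\ f (x0 + v) = f x0 + y.
have PZ t v y : P v y -> P (t *: v) (t *: y).
  have comb (W : lmodType R) (a b : W) : a + t *: b = (1 - t) *: a + t *: (a + b).
    by rewrite scalerBl scale1r scalerDr addrA subrK.
  case=> Av fv; rewrite /P (comb _ x0 v) (comb _ (f x0) y) -fv.
  by rewrite (faff _ _ t (Ax ord0) Av); split => //; apply: (Aaff _ _ t (Ax ord0) Av).
have PD v y w z : P v y -> P w z -> P (v + w) (y + z).
  move=> /(PZ 2)[Av fv] /(PZ 2)[Aw fw].
  have comb (W : lmodType R) (a b c : W) :
      a + (b + c) = (1 - 2^-1) *: (a + 2 *: b) + 2^-1 *: (a + 2 *: c).
    have -> : 1 - 2^-1 = 2^-1 :> R by lra.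
    rewrite !scalerDr !scalerA mulVf ?pnatr_eq0 // !scale1r addrACA -scalerDl.
    by have -> : 2^-1 + 2^-1 = 1 :> R; [lra | rewrite scale1r].
  rewrite /P (comb _ x0 v w) (comb _ (f x0) y z) -fv -fw.
  by rewrite (faff _ _ _ Av Aw); split => //; apply: (Aaff _ _ _ Av Aw).
have [AS fS] : P (\sum_i k i *: (x i - x0)) (\sum_i k i *: (f (x i) - f x0)).
  apply: (big_ind2 P) => [|v y w z|i _].
  - by rewrite /P !addr0; split => //; apply: Ax.
  - exact: PD.
  - apply: PZ; rewrite /P [x0 + _]addrC subrK [f x0 + _]addrC subrK.
    by split => //; apply: Ax.
have shift (W : lmodType R) (g : 'I_n.+1 -> W) (a : W) :
    a + \sum_i k i *: (g i - a) = \sum_i k i *: g i.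
  under eq_bigr do rewrite scalerBr.
  by rewrite sumrB -scaler_suml k1 scale1r addrC subrK.
by rewrite !shift in AS fS; split.
Qed.

Lemma convex_setE (A : set E) : @convex_set R E A <->
  forall x y t, 0 <= t <= 1 -> A x -> A y -> A (t *: x + (1 - t) *: y).
Proof.
split=> [cA x y t /andP[t0 t1] Ax Ay|cA x y t].
  have := cA x y (Itv01 t0 t1); rewrite !inE; exact.
by rewrite !inE => Ax Ay; apply: cA => //; apply/andP; split.
Qed.

Lemma convex_combination (A : set E) n (x : 'I_n -> E) (k : 'I_n -> R) :
  @convex_set R E A -> (forall i, A (x i)) -> (forall i, 0 <= k i) ->
  \sum_i k i = 1 -> A (\sum_i k i *: x i).
Proof.
move=> /convex_setE cA.
elim: n x k => [|n IHn] x k Ax k0 k1.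
  by move/eqP: k1; rewrite big_ord0 eq_sym oner_eq0.
rewrite big_ord_recl in k1; rewrite big_ord_recl.
have s0 : 0 <= \sum_i k (lift ord0 i) by apply: sumr_ge0.
have [k01|k0N1] := eqVneq (k ord0) 1.
  have /eqP : \sum_i k (lift ord0 i) = 0 by lra.
  rewrite psumr_eq0 // => /allP kz; rewrite big1 ?addr0 ?k01 ?scale1r // => i _.
  by have /eqP-> := kz i (mem_index_enum _); rewrite scale0r.
pose t := 1 - k ord0; have t0 : 0 < t by rewrite /t lt_neqAle; apply/andP; split; lra.
pose y := \sum_i (k (lift ord0 i) / t) *: x (lift ord0 i).
have -> : \sum_i k (lift ord0 i) *: x (lift ord0 i) = (1 - k ord0) *: y.
  rewrite scaler_sumr; apply: eq_bigr => i _.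
  by rewrite scalerA mulrCA mulfV ?mulr1 // lt0r_neq0.
apply: cA => //; first by rewrite k0 /=; lra.
apply: IHn => // [i|]; first by rewrite divr_ge0 // ltW.
by rewrite -mulr_suml -[X in X / _](addKr (k ord0)) k1 addrC mulfV // lt0r_neq0.
Qed.

End FixedDimension.

Definition hull n m (X : 'M[R]_(n, m)) : set 'rV[R]_m :=
  [set k *m X | k in [set k : 'rV[R]_n |
    (forall i, 0 <= k 0 i) /\ \sum_i k 0 i = 1]].

Definition affspan n m (X : 'M[R]_(n, m)) : set 'rV[R]_m :=
  [set k *m X | k in [set k : 'rV[R]_n | \sum_i k 0 i = 1]].

Definition rows n m (X : 'M[R]_(n, m)) : set 'rV[R]_m :=
  [set row i X | i in [set: 'I_n]].

Section HullTheory.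
Variables (n m : nat).
Implicit Type X : 'M[R]_(n, m).

Lemma sum_delta (i : 'I_n) : \sum_j (delta_mx 0 i : 'rV[R]_n) 0 j = 1.
Proof.
rewrite (bigD1 i) //= big1 ?mxE ?eqxx ?addr0 // => j /negPf ji.
by rewrite mxE ji.
Qed.

Lemma row_hull X i : hull X (row i X).
Proof.
exists (delta_mx 0 i); last by rewrite -rowE.
by split; [move=> j; rewrite mxE | exact: sum_delta].
Qed.

Lemma sub_hull_affspan X : hull X `<=` affspan X.
Proof. by move=> _ [k [_ k1] <-]; exists k. Qed.

Lemma affspan_affine X : affine_set (affspan X).
Proof.
move=> _ _ t [k k1 <-] [l l1 <-]; exists ((1 - t) *: k + t *: l).
  rewrite /=; under eq_bigr do rewrite !mxE.
  by rewrite big_split -!mulr_sumr k1 l1 /= !mulr1 subrK.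
by rewrite mulmxDl -!scalemxAl.
Qed.

Lemma hull_convex X : @convex_set R 'rV[R]_m (hull X).
Proof.
apply/convex_setE => _ _ t /andP[t0 t1] [k [k0 k1] <-] [l [l0 l1] <-].
exists (t *: k + (1 - t) *: l); last by rewrite mulmxDl -!scalemxAl.
split=> [i|]; first by rewrite !mxE addr_ge0 // mulr_ge0 // subr_ge0.
under eq_bigr do rewrite !mxE.
by rewrite big_split -!mulr_sumr k1 l1 /= !mulr1 addrC subrK.
Qed.

Lemma convex_hull_rows X : convex_hull (rows X) = hull X.
Proof.
apply/seteqP; split.
  by apply: smallest_sub; [exact: hull_convex | move=> _ [i _ <-]; exact: row_hull].
move=> _ [k [k0 k1] <-] A [cA sA]; rewrite mulmx_sum_row.
by apply: convex_combination => // i; apply: sA; exists i.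
Qed.

Lemma affine_hull_hull X : affine_hull (hull X) = affspan X.
Proof.
apply/seteqP; split.
  by apply: smallest_sub; [exact: affspan_affine | exact: sub_hull_affspan].
move=> _ [k k1 <-] A [Aaff sA]; rewrite mulmx_sum_row.
have [||] := @affine_combination _ _ A id _ (fun i => row i X) (k 0) Aaff _ _ k1 => //.
by move=> i; apply: sA; exact: row_hull.
Qed.

Lemma affine_on_affspan (V : lmodType R) X (f : 'rV[R]_m -> V) (k : 'rV_n) :
  affine_on (affspan X) f -> \sum_i k 0 i = 1 ->
  f (k *m X) = \sum_i k 0 i *: f (row i X).
Proof.
move=> faff k1; rewrite mulmx_sum_row.
have [|_ ->//] := affine_combination (x := fun i => row i X) (@affspan_affine X)
  faff _ k1.
by move=> i; apply/sub_hull_affspan/row_hull.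
Qed.

Lemma dilate_hull r X : dilate r (hull X) = hull (r%:R *: X).
Proof.
apply/seteqP; split => [_ [_ [k hk <-] <-]|_ [k hk <-]].
  by exists k => //; rewrite scalemxAr.
by exists (k *m X); [exists k | rewrite scalemxAr].
Qed.

Lemma relint_hull X x : (0 < n)%N -> relint (hull X) x ->
  exists k : 'rV_n, [/\ forall i, 0 < k 0 i, \sum_i k 0 i = 1 & x = k *m X].
Proof.
move=> n0 []; rewrite affine_hull_hull => Xx; rewrite -/(nbhs x).
move/nbhs_ballP => [e /= e0 xe].
have n0R : 0 < n%:R :> R by rewrite ltr0n.
pose u : 'rV[R]_n := const_mx n%:R^-1.
have u1 : \sum_(i < n) n%:R^-1 = 1 :> R.
  by rewrite sumr_const card_ord -[_ *+ n]mulr_natr mulVf // gt_eqF.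
pose b := u *m X; pose d := 1 + `|x - b|; have d0 : 0 < d by rewrite ltr_pwDl.
pose t := e / (2 * d); have t0 : 0 < t by rewrite divr_gt0 // mulr_gt0.
have [k hk xk] := Xx.
have [||l [l0 l1] el] := xe (x + t *: (x - b)).
- rewrite -ball_normE /= opprD addrA subrr add0r normrN normrZ gtr0_norm // /t.
  rewrite mulrAC ltr_pdivrMr ?mulr_gt0 // ltr_pM2l //.
  by have := normr_ge0 (x - b); rewrite /d; lra.
- exists ((1 + t) *: k - t *: u).
    rewrite /=; under eq_bigr do rewrite !mxE.
    by rewrite sumrB -!mulr_sumr u1 (proj2 hk) !mulr1 addrK.
  by rewrite mulmxBl -!scalemxAl xk -/b scalerDl scale1r scalerBr addrA.
exists ((1 + t)^-1 *: (l + t *: u)).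
have t1 : 0 < 1 + t by rewrite addr_gt0.
split.
- move=> i; rewrite !mxE mulr_gt0 ?invr_gt0 // ltr_wpDl // mulr_gt0 //.
  by rewrite invr_gt0.
- under eq_bigr do rewrite !mxE.
  by rewrite -mulr_sumr big_split /= l1 -mulr_sumr u1 mulr1 mulVf // gt_eqF.
- rewrite -scalemxAl mulmxDl -scalemxAl el -/b scalerBr addrA subrK.
  by rewrite -{2}[x]scale1r -scalerDl scalerA mulVf ?scale1r // gt_eqF.
Qed.

End HullTheory.
End Hulls.

Section AffineValues.
Variable R : realType.
Local Open Scope classical_set_scope.
Local Open Scope ring_scope.

(* The row space of [affval X] consists of the value vectors
   (h(x_1), ..., h(x_n)) of the affine functionals h at the rows of [X]. *)
Definition affval n m (X : 'M[R]_(n, m)) : 'M[R]_n :=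
  <<col_mx X^T (const_mx 1 : 'rV_n)>>%MS.

Lemma affvalP n m (X : 'M[R]_(n, m)) (z : 'rV_n) : (z <= affval X)%MS <->
  exists (a : 'cV_m) (b : R), forall i, z 0 i = (row i X *m a) 0 0 + b.
Proof.
rewrite genmxE; split=> [/submxP[D ->]|[a [b zE]]].
  exists (lsubmx D)^T, (rsubmx D 0 0) => i.
  rewrite -[D in LHS]hsubmxK mul_row_col mxE; congr (_ + _).
    by rewrite !mxE; apply: eq_bigr => j _; rewrite !mxE mulrC.
  by rewrite [LHS]mxE big_ord1 [X in _ * X]mxE mulr1.
apply/submxP; exists (row_mx a^T b%:M); rewrite mul_row_col; apply/rowP => i.
rewrite zE [RHS]mxE; congr (_ + _); last by rewrite mxE big_ord1 !mxE mulr1.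
by rewrite !mxE; apply: eq_bigr => j _; rewrite !mxE mulrC.
Qed.

Lemma affval_comb n m (X : 'M[R]_(n, m)) (z l : 'rV_n) (a : 'cV_m) b :
  (forall i, z 0 i = (row i X *m a) 0 0 + b) -> \sum_i l 0 i = 1 ->
  (l *m X *m a) 0 0 + b = \sum_i l 0 i * z 0 i.
Proof.
move=> zE l1; under eq_bigr do rewrite zE mulrDr.
rewrite big_split /= -mulr_suml l1 mul1r; congr (_ + _).
rewrite -mulmxA mxE; apply: eq_bigr => i _; congr (_ * _).
by rewrite -row_mul [RHS]mxE.
Qed.

Lemma const1_affval n m (X : 'M[R]_(n, m)) : ((const_mx 1 : 'rV_n) <= affval X)%MS.
Proof. by apply/affvalP; exists 0, 1 => i; rewrite mulmx0 !mxE add0r. Qed.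

Lemma affval_scale n m (X : 'M[R]_(n, m)) r : r != 0 ->
  (affval (r *: X) :=: affval X)%MS.
Proof.
have sub (Y : 'M[R]_(n, m)) t : (affval (t *: Y) <= affval Y)%MS.
  rewrite /affval !genmxE col_mx_sub linearZ /= scalemx_sub -?addsmxE ?addsmxSl //=.
  exact: addsmxSr.
move=> r0; apply/eqmxP; rewrite sub /=.
by rewrite -{1}[X]scale1r -(mulVf r0) -scalerA sub.
Qed.

Lemma rank_affval n m (X : 'M[R]_(n, m)) i0 :
  \rank (affval X) = (\rank (\matrix_i (row i X - row i0 X))%R).+1.
Proof.
set D := \matrix_i _.
have DX : D^T = X^T - (row i0 X)^T *m (const_mx 1 : 'rV_n).
  by apply/matrixP => i j; rewrite !mxE big_ord1 !mxE mulr1.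
have -> : \rank (affval X) = \rank (D^T + (const_mx 1 : 'rV[R]_n))%MS.
  apply: eqmx_rank; rewrite /affval; apply/andP; rewrite !genmxE -addsmxE; split.
    rewrite addsmx_sub addsmxSr andbT.
    rewrite -[X^T](subrK ((row i0 X)^T *m const_mx 1)) -DX.
    by rewrite addmx_sub ?addsmxSl // (submx_trans (submxMl _ _)) // addsmxSr.
  rewrite -addsmxE addsmx_sub addsmxSr andbT DX addmx_sub ?addsmxSl //.
  by rewrite eqmx_opp (submx_trans (submxMl _ _)) // addsmxSr.
have cap0 : (D^T :&: (const_mx 1 : 'rV[R]_n))%MS = 0.
  apply/eqP/rowV0P => v; rewrite sub_capmx => /andP[/submxP[w wv] /sub_rVP[t vt]].
  have : v 0 i0 = 0.
    by rewrite wv mxE big1 // => j _; rewrite !mxE subrr mulr0.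
  by rewrite vt !mxE mulr1 => ->; rewrite scale0r.
rewrite mxrank_disjoint_sum // mxrank_tr rank_rV.
have -> : (const_mx 1 : 'rV[R]_n) != 0; last by rewrite addn1.
by apply/rV0Pn; exists i0; rewrite mxE oner_eq0.
Qed.

Lemma has_dim_uniq m (A : set 'rV[R]_m) d d' :
  has_dim A d -> has_dim A d' -> d = d'.
Proof.
move=> [x [V [AV <-]]] [x' [V' [+ <-]]]; rewrite AV => e.
have sub (y y' : 'rV[R]_m) (W W' : {vspace 'rV[R]_m}) :
    [set y + v | v in [set` W]] = [set y' + v | v in [set` W']] -> (W <= W')%VS.
  move=> eW; apply/subvP => v Wv.
  have [w /= W'w ew] : [set y' + v | v in [set` W']] (y + v) by rewrite -eW; exists v.
  have [w0 /= W'w0 ew0] : [set y' + v | v in [set` W']] y.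
    by rewrite -eW; exists 0; rewrite ?addr0 //= mem0v.
  suff -> : v = w - w0 by rewrite rpredB.
  by rewrite -[LHS](addKr y) -ew -{1}ew0 opprD addrACA addNr add0r addrC.
by apply/eqP; rewrite eqn_leq !dimvS // (sub _ _ _ _ e, sub _ _ _ _ (esym e)).
Qed.

Lemma has_dim_hull n m (X : 'M[R]_(n, m)) : (0 < n)%N ->
  has_dim (hull X) (\rank (affval X)).-1.
Proof.
move=> n0; pose i0 := Ordinal n0; rewrite (rank_affval _ i0) /=.
set D := \matrix_i _; pose B := row_base D.
have mulD (l : 'rV_n) : l *m D = l *m X - (\sum_i l 0 i) *: row i0 X.
  rewrite !mulmx_sum_row scaler_suml -sumrB; apply: eq_bigr => i _.
  by rewrite rowK scalerBr.
pose f : 'Hom('rV[R]_(\rank D), 'rV[R]_m) := linfun (mulmxr B).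
have fE y : f y = y *m B by rewrite lfunE.
exists (row i0 X), (limg f); split; last first.
  rewrite limg_dim_eq; first by rewrite dimvf /dim /= mul1n.
  apply/eqP; rewrite -subv0; apply/subvP => v; rewrite memv_cap memvf memv_ker fE.
  rewrite memv0 /= => /eqP vB; apply/eqP.
  by apply: (row_free_inj (row_base_free D)); rewrite vB mul0mx.
rewrite affine_hull_hull; apply/seteqP; split => [_ [k k1 <-]|_ [v /= + <-]].
  exists (k *m D); last by rewrite mulD k1 scale1r addrC subrK.
  have /submxP[y ->] : (k *m D <= B)%MS by rewrite eq_row_base submxMl.
  by rewrite /= -fE memv_img // memvf.
case/memv_imgP=> y _ ->; rewrite fE.
have /submxP[l ->] : (y *m B <= D)%MS.
  by rewrite (submx_trans (submxMl _ _)) // eq_row_base.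
exists (l + (1 - \sum_i l 0 i) *: delta_mx 0 i0).
  rewrite /=; under eq_bigr do rewrite mxE [X in _ + X]mxE.
  by rewrite big_split -mulr_sumr sum_delta mulr1 /= addrC subrK.
by rewrite mulmxDl mulD -scalemxAl -rowE scalerBl scale1r addrCA addrA.
Qed.

Lemma facet_vector_rank n m q (X : 'M[R]_(n, m)) theta z (e : 'I_q -> 'I_n) :
  facet_vector (affval X) theta z ->
  (forall i, z 0 i = 0 <-> exists j, e j = i) ->
  \rank (affval X) = (\rank (affval (rowsub e X))).+1.
Proof.
move=> [Cz z0 wz minz] eP.
have -> : \rank (affval (rowsub e X)) = \rank (affval X *m colsub e 1%:M).
  rewrite /affval genmxE (eqmxMr _ (genmxE _)) mul_col_mx !mulmx_colsub !mulmx1.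
  congr (\rank (col_mx _ _)); apply/matrixP => i j; rewrite !mxE //.
rewrite -(mxrank_mul_ker (affval X) (colsub e 1%:M)) -addn1; congr addn.
have -> : (\rank (affval X :&: kermx (colsub e 1%:M)))%MS = \rank z.
  apply/eqmx_rank/andP; split.
    apply/row_subP => i; set v := row i _.
    have : (v <= affval X :&: kermx (colsub e 1%:M))%MS by apply: row_sub.
    rewrite sub_capmx => /andP[Cv /sub_kermxP].
    rewrite mulmx_colsub mulmx1 => ve.
    have [|k ->] := minz v Cv; last exact: scalemx_sub.
    by move=> j /eP[l <-]; have /rowP/(_ l) := ve; rewrite !mxE.
  rewrite sub_capmx Cz; apply/sub_kermxP; rewrite mulmx_colsub mulmx1.
  by apply/rowP => j; rewrite !mxE; apply/eP; exists j.
rewrite rank_rV; suff -> : z != 0 by [].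
apply/eqP => z00; move: wz; rewrite /weight z00 big1 => [/esym/eqP|i _].
  by rewrite oner_eq0.
by rewrite mxE mulr0.
Qed.

End AffineValues.

Section ReflexiveFacets.
Variable R : realType.
Local Open Scope classical_set_scope.
Local Open Scope ring_scope.

Lemma latticeDZ m (t : R) (x y : 'rV[R]_m) :
  t \is a Num.int -> lattice x -> lattice y -> lattice (x + t *: y).
Proof. by move=> tz xz yz i; rewrite !mxE rpredD ?rpredM. Qed.

Variables (n m r : nat) (X : 'M[R]_(n, m)) (k : 'rV[R]_n).
Hypotheses (r_gt0 : (0 < r)%N) (X_int : forall i, lattice (row i X)).
Hypotheses (k_gt0 : forall i, 0 < k 0 i) (k1 : \sum_i k 0 i = 1).
Hypothesis rankX : (1 < \rank (affval X))%N.

Let Q := hull (r%:R *: X).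
Let theta i := r%:R * k 0 i.
Let x := k *m (r%:R *: X).

Hypothesis reflexive_x : forall F, facet Q F -> lattice_distance Q F x 1.

Let rN0 : r%:R != 0 :> R. Proof. by rewrite pnatr_eq0 -lt0n. Qed.

Section OneFacet.
Variables (z : 'rV[R]_n).
Hypothesis z_facet : facet_vector (affval X) theta z.

Let q := #|[pred i | z 0 i == 0]|.
Let e (j : 'I_q) : 'I_n := enum_val j.
Let Y := rowsub e (r%:R *: X).

Let z_ge0 i : 0 <= z 0 i. Proof. by case: z_facet. Qed.

Let eP i : z 0 i = 0 <-> exists j, e j = i.
Proof.
split=> [/eqP zi|[j <-]]; last by have := enum_valP j; rewrite inE => /eqP.
have zi' : i \in [pred i | z 0 i == 0] by rewrite inE.
by exists (enum_rank_in zi' i); rewrite /e enum_rankK_in.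
Qed.

Let rankY : \rank (affval X) = (\rank (affval Y)).+1.
Proof.
rewrite (facet_vector_rank z_facet eP); congr _.+1.
rewrite -(affval_scale (rowsub e X) rN0); congr (\rank (affval _)).
by apply/matrixP => i j; rewrite !mxE.
Qed.

Let q_gt0 : (0 < q)%N.
Proof.
rewrite lt0n; apply/eqP => q0; have := rank_leq_row (affval Y).
by move: rankX; rewrite rankY; lia.
Qed.

Let facetY : facet Q (hull Y).
Proof.
have [[/affvalP[a [b zE]] _ _ _] n_gt0] : facet_vector (affval X) theta z /\ (0 < n)%N.
  by split => //; case: (e (Ordinal q_gt0)) => i; case: (n).
pose h (y : 'rV[R]_m) : R^o := - ((y *m a) 0 0 + r%:R * b).
have hQ (l : 'rV_n) : \sum_i l 0 i = 1 ->
    h (l *m (r%:R *: X)) = - (r%:R * \sum_i l 0 i * z 0 i).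
  move=> l1; rewrite -(affval_comb zE l1) mulrDr /h -scalemxAr -scalemxAl.
  by rewrite [X in - (X + _)]mxE.
split; last first.
  exists (\rank (affval Y)).-1; split; last exact: has_dim_hull.
  have := has_dim_hull (r%:R *: X) n_gt0; rewrite (affval_scale X rN0) rankY /=.
  by rewrite prednK //; move: rankX; rewrite rankY.
exists h, 0; split.
- move=> y1 y2 t _ _; rewrite /h mulmxDl -!scalemxAl mxE [X in - (X + _ + _)]mxE.
  rewrite [X in - (_ + X + _)]mxE; rewrite /GRing.scale /=; ring.
- move=> _ [l [l0 l1] <-]; rewrite hQ // oppr_le0 mulr_ge0 // sumr_ge0 // => i _.
  by rewrite mulr_ge0.
apply/seteqP; split => [_ [w [w0 w1] <-]|_ [[l [l0 l1] <-] /= /eqP]].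
  have -> : w *m Y = (w *m rowsub e 1%:M) *m (r%:R *: X).
    by rewrite -mulmxA mul_rowsub_mx mul1mx.
  set l := w *m rowsub e 1%:M.
  have sum_l (g : 'I_n -> R) : \sum_i l 0 i * g i = \sum_j w 0 j * g (e j).
    under eq_bigr do rewrite mxE mulr_suml.
    rewrite exchange_big; apply: eq_bigr => j _ /=.
    rewrite (bigD1 (e j)) //= big1 ?addr0 => [|i /negPf ij].
      by rewrite !mxE eqxx mulr1.
    by rewrite !mxE eq_sym ij mulr0 mul0r.
  have l1 : \sum_i l 0 i = 1.
    have := sum_l (fun=> 1); under eq_bigr do rewrite mulr1.
    by move=> ->; under eq_bigr do rewrite mulr1.
  split; first exists l => //.
    by split=> // i; rewrite mxE sumr_ge0 // => j _; rewrite !mxE mulr_ge0.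
  rewrite /= hQ // sum_l big1 ?mulr0 ?oppr0 // => j _.
  by rewrite (iffRL (eP (e j))) ?mulr0 //; exists j.
rewrite hQ // oppr_eq0 mulf_eq0 (negPf rN0) /=.
rewrite psumr_eq0 => [|i _]; last by rewrite mulr_ge0.
move=> /allP lz.
have l0e i : z 0 i != 0 -> l 0 i = 0.
  by have := lz i (mem_index_enum i); rewrite mulf_eq0 => /orP[/eqP->//|->].
have sum_e (V : zmodType) (g : 'I_n -> V) : (forall i, l 0 i = 0 -> g i = 0) ->
    \sum_j g (e j) = \sum_i g i.
  move=> g0; rewrite -(big_enum_val g) /= big_mkcond.
  apply: eq_bigr => i _; rewrite inE; case: ifPn => // zi; by rewrite g0 ?l0e.
exists (\row_j l 0 (e j)).
  split=> [j|]; first by rewrite mxE.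
  by under eq_bigr do rewrite mxE; rewrite (sum_e _ (fun i => l 0 i)).
rewrite !mulmx_sum_row.
rewrite -(sum_e _ (fun i => l 0 i *: row i (r%:R *: X))) => [|i ->]; last exact: scale0r.
by apply: eq_bigr => j _; rewrite mxE; congr (_ *: _); apply/rowP => u; rewrite !mxE.
Qed.

Lemma facet_functional : exists (h : 'rV[R]_m -> R^o) (c : R),
  integral_functional Q h /\
  forall i, c - h (r%:R *: row i X) = r%:R * z 0 i.
Proof.
have [h [c [[hint _] hF _ cx]]] := reflexive_x facetY.
have haff : affine_on (affspan (r%:R *: X)) h.
  by case: hint => + _; rewrite affine_hull_hull.
have hE (l : 'rV_n) : \sum_i l 0 i = 1 ->
    h (l *m (r%:R *: X)) = \sum_i l 0 i * h (r%:R *: row i X).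
  move=> l1; rewrite (affine_on_affspan haff l1); apply: eq_bigr => i _.
  by congr (_ *: h _); apply/rowP => j; rewrite !mxE.
exists h, c; split=> //.
pose z' : 'rV[R]_n := \row_i (c - h (r%:R *: row i X)).
have Cz' : (z' <= affval X)%MS.
  rewrite genmxE submxE; apply/eqP/rowP => j; rewrite [RHS]mxE.
  set M := col_mx _ _.
  have [ka kaE] : exists ka : 'rV_n, ka = (col j (cokermx M))^T by eexists.
  have : M *m ka^T = 0 by rewrite kaE trmxK colE mulmxA mulmx_coker mul0mx.
  rewrite mul_col_mx => /eqP; rewrite col_mx_eq0 => /andP[/eqP kaX /eqP ka1].
  have sum_ka : \sum_i ka 0 i = 0.
    have /rowP/(_ 0) := ka1; rewrite !mxE => e0; rewrite -[RHS]e0.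
    by apply: eq_bigr => i _; rewrite !mxE mul1r.
  have kaX0 : ka *m (r%:R *: X) = 0.
    by rewrite -scalemxAr -[ka *m X]trmxK trmx_mul kaX trmx0 scaler0.
  pose i0 := e (Ordinal q_gt0).
  have s1 : \sum_i (delta_mx 0 i0 + ka) 0 i = 1.
    by under eq_bigr do rewrite mxE; rewrite big_split /= sum_delta sum_ka addr0.
  have := hE _ s1; rewrite mulmxDl kaX0 addr0 hE ?sum_delta //.
  under [RHS]eq_bigr do rewrite mxE mulrDl.
  rewrite big_split /= => /eqP.
  rewrite -subr_eq0 opprD addrA subrr add0r oppr_eq0 => /eqP hka.
  transitivity (\sum_i ka 0 i * (c - h (r%:R *: row i X))).
    by rewrite mxE; apply: eq_bigr => i _; rewrite kaE !mxE mulrC.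
  under eq_bigr do rewrite mulrBr.
  by rewrite sumrB hka subr0 -mulr_suml sum_ka mul0r.
have [|kap z'E] := (let: And4 _ _ _ minz := z_facet in minz) z' Cz'.
  move=> i /eP[j <-]; rewrite mxE; apply/eqP; rewrite subr_eq0; apply/eqP/esym/hF.
  have -> : r%:R *: row (e j) X = row j Y by apply/rowP => u; rewrite !mxE.
  exact: row_hull.
have kapE : kap = r%:R.
  have := weightZ theta kap z; rewrite -z'E.
  have [_ _ -> _] := z_facet; rewrite mulr1 => <-.
  rewrite /weight /theta; under eq_bigr do rewrite mxE -mulrA mulrBr.
  rewrite -mulr_sumr sumrB -mulr_suml k1 mul1r -hE // -/x.
  by rewrite (_ : c - _ = 1) ?mulr1 // [RHS]cx.
by move=> i; have /rowP/(_ i) := z'E; rewrite !mxE kapE.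
Qed.

Lemma facet_integral (l : 'rV[R]_n) : \sum_i l 0 i = 1 -> lattice (l *m X) ->
  \sum_i l 0 i * z 0 i \is a Num.int.
Proof.
move=> l1 lX; have [h [c [[haff hint] hE]]] := facet_functional.
pose i0 := e (Ordinal q_gt0).
have zi0 : z 0 i0 = 0 by apply/eP; exists (Ordinal q_gt0).
have rX i : r%:R *: row i X = row i (r%:R *: X) by apply/rowP => j; rewrite !mxE.
have r_int : (r%:R : R) \is a Num.int by rewrite rpred_nat.
have c_int : c \is a Num.int.
  have := hE i0; rewrite zi0 mulr0 => /eqP; rewrite subr_eq0 => /eqP ->.
  apply: hint; first by rewrite affine_hull_hull rX; exact/sub_hull_affspan/row_hull.
  by move=> j; rewrite mxE rpredM //; exact: X_int.
have [d dE] : exists d : 'rV[R]_n, d = delta_mx 0 i0 by eexists.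
have d1 : \sum_i d 0 i = 1 by rewrite dE sum_delta.
pose l' : 'rV_n := d + r%:R^-1 *: (l - d).
have l'E i : l' 0 i = d 0 i + r%:R^-1 * (l 0 i - d 0 i) by rewrite !mxE.
have l'1 : \sum_i l' 0 i = 1.
  under eq_bigr do rewrite l'E.
  by rewrite big_split -mulr_sumr sumrB l1 /= d1 subrr mulr0 addr0.
pose p := l' *m (r%:R *: X).
have pE : p = row i0 (r%:R *: X) + (l *m X - row i0 X).
  rewrite /p mulmxDl {1}dE -rowE; congr (_ + _).
  by rewrite dE -scalemxAl -scalemxAr scalerA mulVf // scale1r mulmxBl -rowE.
have p_int : lattice p.
  rewrite pE -rX addrC; apply: latticeDZ => //.
  by rewrite -scaleN1r; apply: latticeDZ => //; rewrite rpredN1.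
have p_aff : affine_hull Q p by rewrite affine_hull_hull; exists l'.
have hp : h p = c - \sum_i l 0 i * z 0 i.
  rewrite /p (affine_on_affspan _ l'1); last by rewrite -affine_hull_hull.
  transitivity (\sum_i l' 0 i * (c - r%:R * z 0 i)).
    apply: eq_bigr => i _; rewrite -hE rX opprB addrC subrK; reflexivity.
  under eq_bigr do rewrite mulrBr.
  rewrite sumrB -mulr_suml l'1 mul1r; congr (_ - _).
  have sz : \sum_i d 0 i * z 0 i = 0.
    rewrite big1 // => i _; rewrite dE mxE eqxx /=.
    by case: eqP => [->|]; rewrite ?zi0 ?mulr0 ?mul0r.
  transitivity (\sum_i (r%:R - 1) * (d 0 i * z 0 i) + \sum_i l 0 i * z 0 i).
    rewrite -big_split; apply: eq_bigr => i _ /=.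
    by rewrite l'E; field.
  by rewrite -mulr_sumr sz mulr0 add0r.
rewrite -[X in X \is a _](subKr c) -hp rpredB //; exact: hint.
Qed.

End OneFacet.
End ReflexiveFacets.

Section SaturatedBasis.
Variable R : archiRealFieldType.
Local Open Scope ring_scope.

Definition int_mx p q (A : 'M[R]_(p, q)) := forall i j, A i j \is a Num.int.

Lemma int_mxM p q t (A : 'M[R]_(p, q)) (B : 'M[R]_(q, t)) :
  int_mx A -> int_mx B -> int_mx (A *m B).
Proof. by move=> Ai Bi i j; rewrite mxE rpred_sum // => l _; rewrite rpredM. Qed.

Lemma int_pid_mx p q t : int_mx (pid_mx t : 'M[R]_(p, q)).
Proof. by move=> i j; rewrite mxE rpred_nat. Qed.

Lemma int_map_mx p q (A : 'M[int]_(p, q)) : int_mx (map_mx intr A).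
Proof. by move=> i j; rewrite mxE intr_int. Qed.

Lemma int_mxP p q (A : 'M[R]_(p, q)) :
  int_mx A -> exists A' : 'M[int]_(p, q), A = map_mx intr A'.
Proof.
move=> Ai; exists (map_mx Num.floor A); apply/matrixP => i j.
by rewrite !mxE floorK.
Qed.

Lemma saturated_basis p q (D : 'M[R]_(p, q)) : int_mx D ->
  exists (B1 : 'M[R]_(\rank D, q)) (B2 : 'M[R]_(q, \rank D)),
    [/\ int_mx B1, int_mx B2 & D *m B2 *m B1 = D].
Proof.
case/int_mxP=> Dz ->; have [L uL [U uU [d d_sorted ->]]] := int_Smith_normal_form Dz.
rewrite !map_mxM; set Delta := map_mx _ (\matrix_(i, j) _).
pose phi k t := @map_mx int R intr k t.
have unit_phi k (A : 'M[int]_k) : A \in unitmx ->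
    phi _ _ A *m phi _ _ (invmx A) = 1%:M /\ phi _ _ (invmx A) *m phi _ _ A = 1%:M.
  by move=> uA; rewrite /phi -!map_mxM mulmxV // mulVmx // map_mx1.
have [_ VL] := unit_phi _ _ uL; have [UV _] := unit_phi _ _ uU.
have rkE : \rank (phi _ _ L *m Delta *m phi _ _ U) = \rank Delta.
  apply/eqP; rewrite eqn_leq (leq_trans (mxrankM_maxl _ _) (mxrankM_maxr _ _)) /=.
  have {1}-> : Delta =
      phi _ _ (invmx L) *m (phi _ _ L *m Delta *m phi _ _ U) *m phi _ _ (invmx U).
    by rewrite -!mulmxA UV mulmx1 mulmxA VL mul1mx.
  exact: leq_trans (mxrankM_maxl _ _) (mxrankM_maxr _ _).
rewrite -/(phi _ _ L) -/(phi _ _ U) rkE; set t := \rank Delta.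
have DeltaE i j : Delta i j = (d`_i *+ (i == j :> nat))%:~R by rewrite !mxE.
have d_null (i j : nat) : (i <= j)%N -> d`_i = 0 -> d`_j = 0.
  move=> ij di; have [jd|] := ltnP j (size d); last by move=> ?; rewrite nth_default.
  have : (d`_i %| d`_j)%Z.
    move: ij; rewrite leq_eqVlt => /predU1P[->|ij]; first exact: dvdzz.
    apply: (sorted_ltn_nth (@dvdz_trans) 0 d_sorted) => //.
    by rewrite inE (ltn_trans ij).
  by rewrite di dvd0z => /eqP.
have Delta_null i (j : 'I_q) : (t <= j)%N -> Delta i j = 0.
  move=> tj; rewrite DeltaE; case: eqP => [ij|_]; last by rewrite mulr0n.
  have [->|dj] := eqVneq d`_i 0; first by rewrite mul0rn.
  exfalso; suff: (j.+1 <= t)%N by rewrite ltnNge tj.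
  have jp : (j < p)%N by rewrite -ij.
  pose f1 := widen_ord jp; pose f2 := widen_ord (ltn_ord j).
  have -> : j.+1 = \rank (rowsub f1 (colsub f2 Delta)).
    suff -> : rowsub f1 (colsub f2 Delta) = diag_mx (\row_l (d`_l)%:~R).
      rewrite mxrank_unit // unitmxE det_diag unitfE.
      apply/prodf_neq0 => l _; rewrite mxE intr_eq0; apply: contraNneq dj.
      by move=> /(d_null l i); rewrite ij -ltnS ltn_ord => ->.
    apply/matrixP => a b; rewrite !mxE; have -> : (a == b) = (a == b :> nat) by [].
    by case: eqP => _; rewrite ?mulr1n ?mulr0n.
  apply: leq_trans (mxrankS (rowsub_sub _ _)) _.
  by rewrite -[X in colsub _ X]mulmx1 -mulmx_colsub mxrankM_maxl.
exists (pid_mx t *m phi _ _ U), (phi _ _ (invmx U) *m pid_mx t); split.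
- by apply: int_mxM; [exact: int_pid_mx | exact: int_map_mx].
- by apply: int_mxM; [exact: int_map_mx | exact: int_pid_mx].
rewrite !mulmxA -(mulmxA _ (phi _ _ U)) UV mulmx1; congr (_ *m _).
rewrite -!mulmxA; congr (_ *m _); rewrite mul_pid_mx minnn (minn_idPl (leqnn t)).
apply/matrixP => i j; rewrite mxE (bigD1 j) //= big1 ?addr0 => [|l /negPf lj].
  rewrite [X in _ * X]mxE eqxx /=; have [jt|tj] := ltnP j t; first by rewrite mulr1.
  by rewrite Delta_null // mul0r.
by rewrite [X in _ * X]mxE (inj_eq val_inj) lj mulr0.
Qed.

End SaturatedBasis.

Section Pyramids.
Variable R : realType.
Local Open Scope classical_set_scope.
Local Open Scope ring_scope.

Lemma lattice_polytope_hull n m (X : 'M[R]_(n, m)) : (0 < n)%N ->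
  (forall i, lattice (row i X)) -> lattice_polytope (hull X).
Proof.
move=> n0 Xint; exists [seq row i X | i <- enum 'I_n].
have eS : [set` [seq row i X | i <- enum 'I_n]] = rows X.
  apply/seteqP; split=> [y /= /mapP[i _ ->]|_ [i _ <-]]; first by exists i.
  by apply/mapP; exists i => //; rewrite mem_enum.
split; last by rewrite eS convex_hull_rows.
  by rewrite -size_eq0 size_map size_enum_ord -lt0n.
by rewrite eS => _ [i _ <-].
Qed.

Lemma lattice_polytopeP m (A : set 'rV[R]_m) : lattice_polytope A ->
  exists n (X : 'M[R]_(n, m)), [/\ (0 < n)%N, forall i, lattice (row i X),
    injective (fun i => row i X) & A = hull X].
Proof.
move=> [s [s0 sint ->]]; pose X := \matrix_(i < size (undup s)) (undup s)`_i.
have eS : [set` s] = rows X.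
  apply/seteqP; split=> [y /= |_ [i _ <-]].
    rewrite -mem_undup => ys; have lt_y := ys; rewrite -index_mem in lt_y.
    by exists (Ordinal lt_y) => //; rewrite rowK /= nth_index.
  by rewrite /= rowK -mem_undup mem_nth.
exists (size (undup s)), X; split.
- by case: s s0 {sint X eS} => // x s _; rewrite -has_predT has_undup.
- by move=> i; apply: sint; rewrite /= rowK -mem_undup mem_nth.
- move=> i j; rewrite !rowK => /eqP; rewrite nth_uniq ?undup_uniq //.
  by move/eqP/val_inj.
- by rewrite eS convex_hull_rows.
Qed.

Lemma hull_affine_image n m p (X : 'M[R]_(n, m)) (M : 'M[R]_(m, p)) (c : 'rV_p)
    (f := fun y : 'rV[R]_m => y *m M + c) (Xf := \matrix_i f (row i X)) :
  f @` hull X = hull Xf /\ f @` affspan X = affspan Xf.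
Proof.
have fE (k : 'rV[R]_n) : \sum_i k 0 i = 1 -> f (k *m X) = k *m Xf.
  move=> k1; rewrite /f [k *m X]mulmx_sum_row mulmx_suml [RHS]mulmx_sum_row.
  under [RHS]eq_bigr do rewrite rowK scalerDr.
  rewrite big_split /= -scaler_suml k1 scale1r; congr (_ + _).
  by apply: eq_bigr => i _; rewrite scalemxAl.
split; apply/seteqP; split.
- by move=> _ [_ [k kP <-] <-]; exists k => //; rewrite fE //; case: kP.
- move=> _ [k kP <-]; exists (k *m X); first by exists k.
  by rewrite fE //; case: kP.
- by move=> _ [_ [k kP <-] <-]; exists k => //; rewrite fE.
- by move=> _ [k kP <-]; exists (k *m X); [exists k | rewrite fE].
Qed.

Lemma pyramid_of_delta n m (X : 'M[R]_(n, m)) theta v d :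
  (forall i, lattice (row i X)) -> (0 < n)%N ->
  has_dim (hull X) d.+1 -> facet_vector (affval X) theta (delta_mx 0 v) ->
  (forall l : 'rV_n, \sum_i l 0 i = 1 -> lattice (l *m X) ->
     l 0 v \is a Num.int) ->
  lattice_pyramid (hull X).
Proof.
move=> Xint n0 dimX dv_facet v_int; right; exists d.
have rkX : \rank (affval X) = d.+2.
  by have := has_dim_uniq dimX (has_dim_hull X n0); lia.
have [/affvalP[a [b abE]] _ _ _] := dv_facet.
pose q := #|[pred i | i != v]|; pose e (j : 'I_q) : 'I_n := enum_val j.
have e_neq j : e j != v by have := enum_valP j; rewrite inE.
have eP i : i != v -> exists j, e j = i.
  move=> iv; have iv' : i \in [pred i | i != v] by rewrite inE.
  by exists (enum_rank_in iv' i); rewrite /e enum_rankK_in.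
pose Y := rowsub e X.
have rkY : \rank (affval X) = (\rank (affval Y)).+1.
  apply: (facet_vector_rank dv_facet) => i; rewrite mxE eqxx /=.
  split=> [|[j <-]]; last by rewrite (negPf (e_neq j)).
  by have [_ /eqP|/eP//] := eqVneq i v; rewrite oner_eq0.
have q0 : (0 < q)%N.
  by have := rank_leq_row (affval Y); move: rkY; rewrite rkX /Y; lia.
pose j0 := Ordinal q0; pose xb := row (e j0) X; pose xv := row v X.
pose D := \matrix_j (row j Y - row j0 Y).
have rkD : \rank D = d.
  by have := rank_affval Y j0; rewrite -/D; move: rkY; rewrite rkX; lia.
have rowY j : row j Y = row (e j) X by apply/rowP => u; rewrite !mxE.
have rowD j : row j D = row (e j) X - xb by rewrite rowK !rowY.
have D_int : int_mx D.
  move=> i j; rewrite !mxE rpredB //.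
    by have := Xint (e i) j; rewrite mxE.
  by have := Xint (e j0) j; rewrite mxE.
have := saturated_basis D_int; rewrite rkD => -[B1 [B2 [B1_int B2_int DB]]].
have [xb_int xv_int] : lattice xb /\ lattice xv by split; exact: Xint.
have [w wE] : exists w, w = xv - xb by eexists.
have w_int : lattice w.
  by rewrite wE -scaleN1r; apply: latticeDZ => //; rewrite rpredN1.
have ab_row i : (row i X *m a) 0 0 + b = (i == v)%:R.
  by rewrite -abE mxE eqxx.
have ab_v (l : 'rV_n) : \sum_i l 0 i = 1 -> (l *m X *m a) 0 0 + b = l 0 v.
  move=> l1; rewrite (affval_comb abE l1) (bigD1 v) //= big1 ?addr0 => [|i /negPf iv].
    by rewrite mxE !eqxx mulr1.
  by rewrite mxE iv andbF mulr0.
pose M : 'M[R]_(m, d + 1) := row_mx ((1%:M - a *m w) *m B2) a.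
pose c : 'rV_(d + 1) := row_mx (- (xb + b *: w) *m B2) b%:M.
pose f (y : 'rV[R]_m) := y *m M + c.
pose t (y : 'rV[R]_m) := (y *m a) 0 0 + b.
have fE y : f y = row_mx ((y - xb - t y *: w) *m B2) (t y)%:M.
  rewrite /f /M /c mul_mx_row add_row_mx; congr row_mx.
    rewrite mulmxA -mulmxDl; congr (_ *m B2).
    rewrite mulmxBr mulmx1 mulmxA [y *m a]mx11_scalar mul_scalar_mx /t scalerDl.
    by rewrite opprD !opprD !addrA; congr (_ - _); rewrite addrAC.
  by rewrite [y *m a]mx11_scalar -raddfD.
have f_v : f xv = row_mx 0 1.
  by rewrite fE /t ab_row eqxx scale1r -wE subrr mul0mx.
have f_e j : f (row (e j) X) = row_mx (row j D *m B2) 0.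
  by rewrite fE /t ab_row (negPf (e_neq j)) scale0r subr0 rowD (rmorph0 (@scalar_mx R 1)).
(* The first block of [f y] determines [y - xb - t y *: w], which lies in the
   row space of [D]. *)
have back y : affspan X y -> y = xb + (y - xb - t y *: w) *m B2 *m B1 + t y *: w.
  move=> [l l1 <-].
  suff -> : (l *m X - xb - t (l *m X) *: w) *m B2 *m B1 = l *m X - xb - t (l *m X) *: w.
    by rewrite -addrA subrK addrC subrK.
  have gE : l *m X - xb - t (l *m X) *: w =
      \sum_i l 0 i *: (row i X - xb - (i == v)%:R *: w).
    transitivity (\sum_i (l 0 i *: row i X - l 0 i *: xb - (l 0 i * (i == v)%:R) *: w)).
      2: by apply: eq_bigr => i _; rewrite scalerBr (scalerBr _ _ xb) scalerA.
    rewrite 2!sumrB -2!scaler_suml l1 scale1r -mulmx_sum_row; congr (_ - _ *: _).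
    rewrite /t ab_v // (bigD1 v) //= eqxx mulr1 big1 ?addr0 // => i /negPf->.
    by rewrite mulr0.
  rewrite gE !mulmx_suml; apply: eq_bigr => i _; rewrite -!scalemxAl; congr (_ *: _).
  have [->|/eP[j <-]] := eqVneq i v.
    by rewrite scale1r -wE subrr !mul0mx.
  by rewrite scale0r subr0 -rowD -!row_mul DB.
pose Bm := D *m B2; exists (hull Bm).
have Bm_int j : lattice (row j Bm) by move=> u; rewrite mxE; apply: int_mxM.
split=> //; first exact: lattice_polytope_hull.
have [f_hull f_aff] := hull_affine_image X M c; rewrite -/f in f_hull f_aff.
set Xf := \matrix_i f (row i X) in f_hull f_aff.
have rowXf i : row i Xf = f (row i X) by rewrite rowK.
have pyrE : pyramid_over (hull Bm) = hull Xf.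
  apply/seteqP; split.
    apply: smallest_sub; first exact: hull_convex.
    move=> y [[_ [k [k0 k1] <-] <-]| ->]; last first.
      by rewrite -f_v -rowXf; exact: row_hull.
    have -> : row_mx (k *m Bm) 0 = \sum_j k 0 j *: row (e j) Xf :> 'rV[R]_(d + 1).
      under eq_bigr do rewrite rowXf f_e scale_row_mx scaler0.
      rewrite [LHS](_ : _ = k *m row_mx Bm 0); last by rewrite mul_mx_row mulmx0.
      rewrite mulmx_sum_row; apply: eq_bigr => j _.
      by rewrite row_row_mx row0 scale_row_mx scaler0 row_mul.
    apply: convex_combination => //; first exact: hull_convex.
    by move=> j; exact: row_hull.
  rewrite -convex_hull_rows; apply: sub_smallest2r.
    move=> x y l; rewrite !inE => Ax Ay B [cB sB]; have := cB x y l.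
    by rewrite !inE; apply; [apply: Ax | apply: Ay].
  move=> _ [i _ <-]; rewrite rowXf.
  have [->|/eP[j <-]] := eqVneq i v; first by right; rewrite f_v.
  left; rewrite f_e; exists (row j Bm); first exact: row_hull.
  by rewrite row_mul.
exists f; rewrite pyrE !affine_hull_hull -f_aff; split.
- move=> y z u _ _; rewrite /f mulmxDl -!scalemxAl !scalerDr addrACA -[in RHS]scalerDl.
  by rewrite subrK scale1r.
- split.
  + by move=> y Xy; exists y.
  + move=> y z; rewrite !inE => Xy Xz; rewrite !fE => /eq_row_mx[e1 /matrixP/(_ 0 0)].
    rewrite !mxE !mulr1n => e2.
    by rewrite (back y Xy) e1 e2 -back.
  + by [].
- apply/seteqP; split=> [_ [y [Xy yint] <-]|_ [[y Xy <-] fyint]].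
    split; first by exists y.
    have ty_int : t y \is a Num.int.
      by case: Xy yint => l l1 <- lint; rewrite /t ab_v // v_int.
    have g_int : lattice (y - xb - t y *: w).
      rewrite -scaleNr; apply: latticeDZ; rewrite ?rpredN //.
      by rewrite -scaleN1r; apply: latticeDZ => //; rewrite rpredN1.
    move=> i; rewrite fE mxE; case: fintype.splitP => j _; last by rewrite mxE ord1 eqxx.
    by apply: int_mxM => // u s; rewrite ord1; exact: g_int.
  exists y => //; split=> //.
  move: fyint; rewrite fE => fint.
  have ty_int : t y \is a Num.int.
    by have := fint (rshift d 0); rewrite row_mxEr mxE eqxx.
  have g_int : lattice ((y - xb - t y *: w) *m B2).
    by move=> i; have := fint (lshift 1 i); rewrite row_mxEl.
  rewrite (back y Xy); apply: latticeDZ => //.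
  rewrite -[X in _ + X]scale1r; apply: latticeDZ => //; rewrite ?rpred1 //.
  by move=> i; apply: int_mxM => // u s; rewrite ord1; exact: g_int.
- exact: f_hull.
Qed.

End Pyramids.

Local Open Scope classical_set_scope.

Theorem theorem2p1 (R : realType) (m d s : nat) (P : set 'rV[R]_m)
  (HP : gorenstein P) (Hd : has_dim P d) (Hs : has_degree P s)
  (Hds : (3 * s <= d)%N) : lattice_pyramid P.
Proof.
have [/lattice_polytopeP[n [X [n0 Xint Xinj PE]]] [r [r0 [_ [x xP]]]]] := HP.
have [xint xrel xdist] := xP.
have [d' [r' [Hd' [_ _ r'min] sr']]] := Hs.
have ed : d' = d := has_dim_uniq Hd' Hd.
have r'r : (r' <= r)%N.
  apply: r'min => // hol.
  by have : (relint (dilate r P) `&` lattice) x by []; rewrite hol.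
subst P; rewrite dilate_hull in xrel xdist.
have rkX : \rank (affval X) = d.+1.
  have := has_dim_uniq Hd (has_dim_hull X n0).
  have := rank_affval X (Ordinal n0); lia.
case: d => [|d] in Hd Hds Hd' ed sr' rkX *.
  left; exists (row (Ordinal n0) X); split; first exact: Xint.
  have [y [V [hullE /eqP]]] := Hd; rewrite dimv_eq0 => /eqP V0.
  have eqy u : hull X u -> u = y.
    move=> /sub_hull_affspan; rewrite -affine_hull_hull hullE V0 => -[v /=].
    by rewrite memv0 => /eqP-> <-; rewrite addr0.
  apply/seteqP; split=> [u /eqy->|u ->]; last exact: row_hull.
  by rewrite (eqy _ (row_hull X (Ordinal n0))).
have [k [k_gt0 k1 xE]] := relint_hull n0 xrel.
rewrite xE in xdist.
have rk1 : (1 < \rank (affval X))%N by rewrite rkX.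
pose theta i : R := (r%:R * k 0 i)%R.
have fint := facet_integral r0 Xint k1 rk1 xdist.
have [|||||||v fv] := @exists_delta_facet R n (affval X) theta r s.
- by move=> i; rewrite mulr_gt0 ?ltr0n.
- exact: const1_affval.
- move=> v w vw; apply: Xinj; apply/rowP => j.
  have := vw (col j X)^T%R; rewrite !mxE; apply.
  apply/affvalP; exists (delta_mx j 0)%R, 0%R => i.
  by rewrite addr0 -colE !mxE.
- move=> F i fF.
  have : (F 0 i \is a Num.int)%R.
    have := fint F fF (delta_mx 0 i)%R (sum_delta R i).
    rewrite -rowE => /(_ (Xint i)).
    rewrite (bigD1 i) //= big1 ?addr0 => [|l /negPf li]; last first.
      by rewrite mxE li andbF mul0r.
    by rewrite mxE !eqxx mul1r.
  have : (0 <= F 0 i)%R by case: fF.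
  move=> F0 /intrP[z zE]; rewrite zE in F0 *.
  case: z F0 {zE} => [[|[|z]]|z] F0; [constructor 1|constructor 2|constructor 3|] => //.
    by rewrite -[2%R]/(2%:~R)%R ler_int.
  by move: F0; rewrite ler0z.
- by rewrite /theta -mulr_sumr k1 mulr1.
- rewrite rkX; lia.
- rewrite rkX; lia.
apply: (pyramid_of_delta Xint n0 Hd fv) => l l1 lX.
have := fint _ fv l l1 lX.
rewrite (bigD1 v) //= big1 ?addr0 => [|i /negPf iv]; last by rewrite mxE iv andbF mulr0.
by rewrite mxE !eqxx mulr1.
Qed.
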